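(* Let $M$ be a smooth oriented manifold of dimension $n$ and let $\nabla_a$ be a special torsion-free connection on $TM$. There is a one-to-one correspondence between solutions of $$\nabla_a\sigma^{bc}=\delta_a{}^b\mu^c+\delta_a{}^c\mu^b\quad\text{for some vector field }\mu^a$$ for positive definite symmetric contravariant $2$-tensors $\sigma^{bc}$ on $M$, and metric connections that are projectively equivalent to $\nabla_a$.
   Context: Abstract index notation is used: indices mark tensor type, repeated indices denote the natural pairing, and $\delta_a{}^b$ is the identity endomorphism. All objects are smooth. Two torsion-free connections $\nabla$ and $\hat\nabla$ on $TM$ are projectively equivalent if they have the same geodesics as unparameterised curves; equivalently, there is a $1$-form $\Upsilon_a$ such that $\hat\nabla_aX^b=\nabla_aX^b+\Upsilon_aX^b+\delta_a{}^b\Upsilon_cX^c$ for all vector fields $X^b$. A torsion-free connection $\nabla$ is called special if there is a (nowhere vanishing) volume form $\epsilon_{bc\cdots d}$ on $M$ with $\nabla_a\epsilon_{bc\cdots d}=0$. A metric connection is the Levi-Civita connection of a Riemannian metric on $M$.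
   Formalization: A metric connection is counted together with its Riemannian metric, so proportional metrics with the same Levi-Civita connection are distinct; for bare connections the correspondence fails, since σ and cσ with c > 0 constant give the same connection. *)

(* Defs.v *)
From mathcomp Require Import all_boot all_order all_algebra perm.
From mathcomp Require Import all_classical all_reals all_analysis.
Import Order.TTheory GRing.Theory Num.Theory numFieldNormedType.Exports.

Set Implicit Arguments.
Unset Strict Implicit.
Unset Printing Implicit Defensive.

Local Open Scope classical_set_scope.
Local Open Scope ring_scope.

(* Tensor fields and connections are given by their components in the charts
   of an atlas, related by the classical transformation laws on overlaps. *)

Section Smooth.
Variables (R : realType) (n : nat).

Definition partial (a : 'I_n) (f : 'rV[R]_n -> R) (x : 'rV[R]_n) : R :=
  'D_(delta_mx 0 a) f x.

(* Being of class C^k on U, for an open U. *)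
Fixpoint Ck (k : nat) (U : set 'rV[R]_n) (f : 'rV[R]_n -> R) : Prop :=
  match k with
  | 0 => forall x, U x -> {for x, continuous f}
  | k'.+1 => (forall x, U x -> differentiable f x) /\
             (forall a, Ck k' U (partial a f))
  end.

Definition smooth_on (U : set 'rV[R]_n) (f : 'rV[R]_n -> R) : Prop :=
  forall k, Ck k U f.

End Smooth.

(* [cmap] and [cinv] are total functions, meaningful only on [cdom] and on
   its image, respectively. *)
Record chart (R : realType) (n : nat) (M : topologicalType) := Chart {
  cdom : set M;
  cmap : M -> 'rV[R]_n;
  cinv : 'rV[R]_n -> M;
  cdom_open : open cdom;
  cimg_open : open (cmap @` cdom);
  cmapK : forall p, cdom p -> cinv (cmap p) = p;
  cmap_continuous : forall p, cdom p -> {for p, continuous cmap};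
  cinv_continuous : forall x, (cmap @` cdom) x -> {for x, continuous cinv}
}.

Definition coord (R : realType) (n : nat) (M : topologicalType)
    (f : chart R n M) (c : 'I_n) (p : M) : R := cmap f p 0 c.

(* The atlas need not be maximal. *)
Record manifold (R : realType) (n : nat) (M : topologicalType) := Manifold {
  idx : Type;
  charts :> idx -> chart R n M;
  manifold_hausdorff : hausdorff_space M;
  manifold_second_countable : @second_countable M;
  charts_cover : forall p, exists i, cdom (charts i) p;
  charts_smooth : forall i j c,
    smooth_on (cmap (charts i) @` (cdom (charts i) `&` cdom (charts j)))
              (fun x => coord (charts j) c (cinv (charts i) x))
}.

Section Tensors.
Variables (R : realType) (n : nat) (M : topologicalType).
Variable A : manifold R n M.

(* With x = [cmap (A i)] and y = [cmap (A j)]: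
   [jac i j p b c] is dy^c/dx^b at p, and
   [hess i j p a b c] is d^2 y^c / dx^a dx^b at p. *)
Definition jac (i j : idx A) (p : M) (b c : 'I_n) : R :=
  partial b (fun x => coord (A j) c (cinv (A i) x)) (cmap (A i) p).

Definition hess (i j : idx A) (p : M) (a b c : 'I_n) : R :=
  partial a (partial b (fun x => coord (A j) c (cinv (A i) x))) (cmap (A i) p).

(* [orient i p] tells whether the chart i is positively oriented at p. *)
Record orientation := Orientation {
  orient : idx A -> M -> bool;
  orient_locally_constant : forall i p, cdom (A i) p ->
    \forall q \near p, orient i q = orient i p;
  orient_compat : forall i j p, cdom (A i) p -> cdom (A j) p ->
    (orient i p == orient j p) = (0 < \det (\matrix_(b, c) jac i j p b c))
}.

(* Components with k upper and l lower indices: [T i p u w] is the component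
   T^{u_0 ... u_(k-1)}_{w_0 ... w_(l-1)} at p in the chart i. *)
Definition components (k l : nat) :=
  idx A -> M -> {ffun 'I_k -> 'I_n} -> {ffun 'I_l -> 'I_n} -> R.
Identity Coercion components_Funclass : components >-> Funclass.

(* T is a smooth tensor field of type (k,l) on the open set U. *)
Definition tensor_on (U : set M) (k l : nat) (T : components k l) : Prop :=
  (forall i u w, smooth_on (cmap (A i) @` (U `&` cdom (A i)))
                           (fun x => T i (cinv (A i) x) u w)) /\
  (forall i j p, U p -> cdom (A i) p -> cdom (A j) p -> forall u w,
     T j p u w =
     \sum_(u' : {ffun 'I_k -> 'I_n}) \sum_(w' : {ffun 'I_l -> 'I_n})
       (\prod_s jac i j p (u' s) (u s)) * (\prod_s jac j i p (w s) (w' s)) *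
       T i p u' w').

(* Components in a chart are required to be 0 outside the chart domain, so that
   Leibniz equality of records is equality of tensor fields. *)
Record tensor (k l : nat) := Tensor {
  tcomp :> components k l;
  tensorP : tensor_on setT tcomp;
  tensor_out : forall i p u w, ~ cdom (A i) p -> tcomp i p u w = 0
}.

(* A connection on TM: [christoffel i p a b c] is Gamma_{ab}^c at p in the
   chart i, with  nabla_a X^c = d_a X^c + Gamma_{ab}^c X^b. *)
Record connection := Connection {
  christoffel : idx A -> M -> 'I_n -> 'I_n -> 'I_n -> R;
  christoffel_smooth : forall i a b c,
    smooth_on (cmap (A i) @` cdom (A i))
              (fun x => christoffel i (cinv (A i) x) a b c);
  christoffel_change : forall i j p, cdom (A i) p -> cdom (A j) p ->
    forall a b d,
      \sum_c christoffel i p a b c * jac i j p c d =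
      hess i j p a b d +
      \sum_e \sum_f christoffel j p e f d * jac i j p a e * jac i j p b f;
  christoffel_out : forall i p a b c,
    ~ cdom (A i) p -> christoffel i p a b c = 0
}.

Definition torsion_free (D : connection) : Prop :=
  forall i p, cdom (A i) p ->
    forall a b c, christoffel D i p a b c = christoffel D i p b a c.

Definition subst_idx (k : nat) (u : {ffun 'I_k -> 'I_n}) (s : 'I_k) (c : 'I_n) :
  {ffun 'I_k -> 'I_n} := [ffun t => if t == s then c else u t].

(* [covD D T i p a u w] is the component nabla_a T^{u}_{w} at p in chart i. *)
Definition covD (D : connection) (k l : nat) (T : components k l)
    (i : idx A) (p : M) (a : 'I_n)
    (u : {ffun 'I_k -> 'I_n}) (w : {ffun 'I_l -> 'I_n}) : R :=
  partial a (fun x => T i (cinv (A i) x) u w) (cmap (A i) p)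
  + \sum_(s < k) \sum_c christoffel D i p a c (u s) * T i p (subst_idx u s c) w
  - \sum_(s < l) \sum_c christoffel D i p a (w s) c * T i p u (subst_idx w s c).

Definition idx0 : {ffun 'I_0 -> 'I_n} := ffun0 (card_ord 0).
Definition idx1 (a : 'I_n) : {ffun 'I_1 -> 'I_n} := [ffun=> a].
Definition idx2 (a b : 'I_n) : {ffun 'I_2 -> 'I_n} :=
  [ffun s => if s == ord0 then a else b].

Definition delta (a b : 'I_n) : R := (a == b)%:R.

Definition volume_form (e : tensor 0 n) : Prop :=
  (forall i p, cdom (A i) p -> forall (w : {ffun 'I_n -> 'I_n}) (s : 'S_n),
     e i p idx0 [ffun t => w (s t)] = (-1) ^+ s * e i p idx0 w) /\
  (forall i p, cdom (A i) p -> exists w, e i p idx0 w != 0).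

Definition special (D : connection) : Prop :=
  torsion_free D /\
  exists e : tensor 0 n, volume_form e /\
    forall i p, cdom (A i) p -> forall a w, covD D e i p a idx0 w = 0.

(* The vector fields X range over those defined on open subsets of M. *)
Definition projectively_equivalent (D D' : connection) : Prop :=
  exists Y : tensor 0 1,
    forall (U : set M) (X : components 1 0), open U -> tensor_on U X ->
    forall i p, U p -> cdom (A i) p -> forall a b,
      covD D' X i p a (idx1 b) idx0 =
      covD D X i p a (idx1 b) idx0
      + Y i p idx0 (idx1 a) * X i p (idx1 b) idx0
      + delta a b * \sum_c Y i p idx0 (idx1 c) * X i p (idx1 c) idx0.

Definition posdef_contravariant (s : tensor 2 0) : Prop :=
  forall i p, cdom (A i) p ->
    (forall b c, s i p (idx2 b c) idx0 = s i p (idx2 c b) idx0) /\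
    (forall v : 'rV[R]_n, v != 0 ->
       0 < \sum_b \sum_c s i p (idx2 b c) idx0 * v 0 b * v 0 c).

Definition riemannian_metric (g : tensor 0 2) : Prop :=
  forall i p, cdom (A i) p ->
    (forall b c, g i p idx0 (idx2 b c) = g i p idx0 (idx2 c b)) /\
    (forall v : 'rV[R]_n, v != 0 ->
       0 < \sum_b \sum_c g i p idx0 (idx2 b c) * v 0 b * v 0 c).

Definition levi_civita (g : tensor 0 2) (D : connection) : Prop :=
  torsion_free D /\
  forall i p, cdom (A i) p -> forall a b c, covD D g i p a idx0 (idx2 b c) = 0.

(* The metric is part of the data: proportional metrics have the same
   Levi-Civita connection but count as different metric connections. *)
Record metric_connection := MetricConnection {
  mc_metric : tensor 0 2;
  mc_conn :> connection;
  mc_riemannian : riemannian_metric mc_metric;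
  mc_levi_civita : levi_civita mc_metric mc_conn
}.

Definition metrisability_equation (D : connection) (s : tensor 2 0) : Prop :=
  exists m : tensor 1 0, forall i p, cdom (A i) p -> forall a b c,
    covD D s i p a (idx2 b c) idx0 =
    delta a b * m i p (idx1 c) idx0 + delta a c * m i p (idx1 b) idx0.

(* The inverse metric g^{ab} is a positive multiple of s^{ab} at each point. *)
Definition inverse_conformal_to (g : tensor 0 2) (s : tensor 2 0) : Prop :=
  exists2 f : M -> R, (forall p, 0 < f p) &
    forall i p, cdom (A i) p -> forall a c,
      \sum_b (f p * s i p (idx2 a b) idx0) * g i p idx0 (idx2 b c) = delta a c.

Definition posdef_solution (D : connection) : Type :=
  {s : tensor 2 0 | posdef_contravariant s /\ metrisability_equation D s}.

Definition equivalent_metric_connection (D : connection) : Type :=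
  {D' : metric_connection | projectively_equivalent D D'}.

End Tensors.

(* Main.v *)
(* Fix a parallel volume form e and, for a symmetric sigma^ab, let det sigma be the
   scalar obtained by contracting sigma^(n) with two copies of e. To a solution
   sigma corresponds the metric with inverse g^ab = (det sigma) sigma^ab. Put
   Y_a = - sigma_ab mu^b. The equation then says that the connection
   Gamma + Y_a delta_b^c + delta_a^c Y_b differentiates sigma into 2 Y_a sigma; by
   Jacobi's formula its action on det sigma is d_a (det sigma) = - 2 Y_a det sigma,
   so it preserves g^ab. Being torsion-free, it is the Levi-Civita connection of g.
   Conversely, if the Levi-Civita connection of g is projectively equivalent to
   nabla through Y, then d_a det(g^-1) = - 2 (n+1) Y_a det(g^-1), and
   sigma = det(g^-1)^(-1/(n+1)) g^-1 solves the equation with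
   mu^b = - Y_a sigma^ab. *)
From HB Require Import structures.
Require Import Defs.
From mathcomp Require Import all_boot all_order all_algebra.
From mathcomp Require Import all_classical all_reals all_analysis.
From mathcomp Require Import perm ring lra.
Import Order.TTheory GRing.Theory Num.Theory numFieldNormedType.Exports.

Set Implicit Arguments.
Unset Strict Implicit.
Unset Printing Implicit Defensive.

Local Open Scope classical_set_scope.
Local Open Scope ring_scope.

(** * Smooth functions on open sets of coordinate space *)

(** In a chart every tensor becomes a matrix or a row ([up2], [lo2], [up1], [lo1]), and a connection
    in a fixed direction becomes a matrix ([gam]). The argument is then matrix algebra at one point,
    plus the derivatives of a product, an inverse and a determinant. No Levi-Civita connection is
    constructed from its metric. In one direction it arises as a projective change of nabla, whose
    transformation law is inherited because the change is tensorial; in the other it is given. Only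
    its uniqueness is proved, so that a metric determines its metric connection. The number n + 1 is
    a trace: contracting b with c in Y_a delta_b^c + delta_a^c Y_b gives n Y_a + Y_a. The
    correspondence is handled as the relation [metric_of] between sigma and g. Existence in both
    directions and uniqueness on both sides make it the graph of a bijection. *)

Lemma near_eq_differentiable (R : numFieldType) (V W : normedModType R)
    (f g : V -> W) (a : V) :
  (\near a, f a = g a) -> differentiable f a -> differentiable g a.
Proof.
move=> fg /diff_locallyP [dfc dfE].
have fga : f a = g a := nbhs_singleton fg.
have gE : g \o shift a = cst (g a) + 'd f a +o_ 0 id.
  apply/eqaddoP => e e0.
  have /eqaddoP/(_ e e0) dfe := dfE.
  have fg0 : \forall h \near 0, f (h + a) = g (h + a).
    by move: fg; rewrite (near_shift 0) /= subr0.
  near=> h.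
  have -> : (g \o shift a - (cst (g a) + 'd f a)) h =
            (f \o shift a - (cst (f a) + 'd f a)) h.
    rewrite !fctE /= fga; congr (_ - _).
    by apply/esym; near: h.
  by near: h; exact: dfe.
by apply/diff_locallyP; rewrite (diff_unique dfc gE).
Unshelve. all: by end_near. Qed.

Section Partial.
Variables (R : realType) (n : nat).
Implicit Types (f g : 'rV[R]_n -> R) (x : 'rV[R]_n) (a : 'I_n).

Lemma open_eq_near (U : set 'rV[R]_n) f g x :
  open U -> {in U, f =1 g} -> U x -> \near x, f x = g x.
Proof.
move=> oU fg Ux; near=> y; apply: fg; rewrite inE.
by near: y; exact: open_nbhs_nbhs.
Unshelve. all: by end_near. Qed.

Lemma open_eq_partial (U : set 'rV[R]_n) f g a x :
  open U -> {in U, f =1 g} -> U x -> partial a f x = partial a g x.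
Proof. by move=> oU fg Ux; apply: near_eq_derive; exact: open_eq_near fg Ux. Qed.

Lemma open_eq_differentiable (U : set 'rV[R]_n) f g x :
  open U -> {in U, f =1 g} -> U x -> differentiable f x -> differentiable g x.
Proof.
by move=> oU fg Ux; apply: near_eq_differentiable; exact: open_eq_near fg Ux.
Qed.

Lemma partial_cst (c : R) a x : partial a (fun=> c) x = 0.
Proof. exact: derive_cst. Qed.

Lemma partialD f g a x : differentiable f x -> differentiable g x ->
  partial a (fun y => f y + g y) x = partial a f x + partial a g x.
Proof. by move=> df dg; apply: deriveD; exact: diff_derivable. Qed.

Lemma partialM f g a x : differentiable f x -> differentiable g x ->
  partial a (fun y => f y * g y) x = partial a f x * g x + f x * partial a g x.
Proof.
move=> df dg; rewrite [LHS]deriveM; [|exact: diff_derivable..].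
by rewrite addrC mulrC.
Qed.

Lemma partialV f a x : differentiable f x -> f x != 0 ->
  partial a (fun y => (f y)^-1) x = - ((f x)^-1 * (f x)^-1 * partial a f x).
Proof.
move=> df fx0; rewrite [LHS]deriveV//; last exact: diff_derivable.
by rewrite scaleNr expr2 invfM.
Qed.

Lemma partial_comp (h : R -> R) f a x dh : is_derive (f x) 1 h dh ->
  differentiable f x ->
  differentiable (fun y => h (f y)) x /\
  partial a (fun y => h (f y)) x = dh * partial a f x.
Proof.
move=> [hd <-] df; have dhf : differentiable h (f x) by exact/derivable1_diffP.
have dhof : differentiable (h \o f) x by exact: differentiable_comp.
split=> //; rewrite /partial [LHS]deriveE// (diff_comp df dhf) /= diff1E//.
by rewrite derive1E -(deriveE _ df); exact: mulrC.
Qed.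

Lemma differentiable_bigsum (I : Type) (r : seq I) (P : pred I) (F : I -> 'rV[R]_n -> R) x :
  (forall i, differentiable (F i) x) ->
  differentiable (fun y => \sum_(i <- r | P i) F i y) x.
Proof.
move=> dF; elim: r => [|i r IH].
  by under eq_fun do rewrite big_nil; exact: differentiable_cst.
under eq_fun do rewrite big_cons; case: (P i) => //.
exact: (differentiableD (dF i) IH).
Qed.

Lemma partial_sum (I : Type) (r : seq I) (P : pred I) (F : I -> 'rV[R]_n -> R) a x :
  (forall i, differentiable (F i) x) ->
  partial a (fun y => \sum_(i <- r | P i) F i y) x =
  \sum_(i <- r | P i) partial a (F i) x.
Proof.
move=> dF; elim: r => [|i r IH].
  by under eq_fun do rewrite big_nil; rewrite big_nil partial_cst.
under eq_fun do rewrite big_cons; rewrite big_cons; case: (P i) => //.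
by rewrite partialD// ?IH//; exact: differentiable_bigsum.
Qed.

Lemma differentiable_bigprod (I : Type) (r : seq I) (F : I -> 'rV[R]_n -> R) x :
  (forall i, differentiable (F i) x) ->
  differentiable (fun y => \prod_(i <- r) F i y) x.
Proof.
move=> dF; elim: r => [|i r IH].
  by under eq_fun do rewrite big_nil; exact: differentiable_cst.
under eq_fun do rewrite big_cons.
exact: (differentiableM (dF i) IH).
Qed.

(** [uniq r] matters: the condition [j != i] would remove every copy of a repeated factor, not just
    one. *)
Lemma partial_prod (I : eqType) (r : seq I) (F : I -> 'rV[R]_n -> R) a x :
  uniq r -> (forall i, differentiable (F i) x) ->
  partial a (fun y => \prod_(i <- r) F i y) x =
  \sum_(i <- r) partial a (F i) x * \prod_(j <- r | j != i) F j x.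
Proof.
move=> + dF; elim: r => [|i r IH].
  by under eq_fun do rewrite big_nil; rewrite big_nil partial_cst.
under eq_fun do rewrite big_cons; move=> /= /andP[ir /IH {}IH].
rewrite partialM//; last exact: differentiable_bigprod.
rewrite IH big_cons; congr (_ * _ + _).
  rewrite big_cons eqxx /= [LHS]big_seq [RHS]big_seq_cond.
  apply: eq_bigl => j; case: eqVneq => [->|]; rewrite ?(negPf ir)// andbT //.
rewrite big_distrr /= big_seq [RHS]big_seq; apply: eq_bigr => j jr.
rewrite big_cons (_ : i != j); first by rewrite mulrCA.
by apply: contraNneq ir => ->.
Qed.

End Partial.

Section Smooth.
Variables (R : realType) (n : nat) (U : set 'rV[R]_n).
Hypothesis oU : open U.
Implicit Types (f g : 'rV[R]_n -> R).

(** As U is open, agreement on U passes to the partial derivatives, which carries the induction. The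
    rules below need this because their derivative formulas hold only on U. *)
Lemma Ck_ext k f g : {in U, f =1 g} -> Ck k U f -> Ck k U g.
Proof.
elim: k f g => [|k IH] f g fg /=.
  move=> fc x Ux; have fgx : f x = g x by apply: fg; rewrite inE.
  apply: cvg_trans (_ : f @ x --> g x); last by rewrite -fgx; exact: fc.
  exact: (@near_eq_cvg _ _ (nbhs x) (nbhs_filter x) _ _ (open_eq_near oU fg Ux)).
move=> [df Cf]; split => [x Ux|a]; first exact: open_eq_differentiable fg Ux (df x Ux).
by apply: IH (Cf a) => x; rewrite inE => Ux; exact: open_eq_partial fg Ux.
Qed.

Lemma CkS k f : Ck k.+1 U f -> Ck k U f.
Proof.
elim: k f => [|k IH] f /= [df Cf]; last by split=> // a; exact: IH.
by move=> x Ux; exact/differentiable_continuous/df.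
Qed.

Lemma Ck_cst k (c : R) : Ck k U (fun=> c).
Proof.
elim: k c => [|k IH] c /=; first by move=> x _; exact/differentiable_continuous/differentiable_cst.
split=> [x _|a]; first exact: differentiable_cst.
by apply: Ck_ext (IH 0) => x _; rewrite partial_cst.
Qed.

Lemma CkD k f g : Ck k U f -> Ck k U g -> Ck k U (fun x => f x + g x).
Proof.
elim: k f g => [|k IH] f g /=; first by move=> cf cg x Ux; apply: continuousD; [exact: cf|exact: cg].
move=> [df Cf] [dg Cg]; split=> [x Ux|a]; first exact: differentiableD (df x Ux) (dg x Ux).
apply: Ck_ext (IH _ _ (Cf a) (Cg a)) => x; rewrite inE => Ux.
by rewrite partialD//; [exact: df|exact: dg].
Qed.

Lemma CkM k f g : Ck k U f -> Ck k U g -> Ck k U (fun x => f x * g x).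
Proof.
elim: k f g => [|k IH] f g; first by move=> /= cf cg x Ux; apply: continuousM; [exact: cf|exact: cg].
move=> Sf Sg; have [df Cf] := Sf; have [dg Cg] := Sg.
split=> [x Ux|a]; first exact: differentiableM (df x Ux) (dg x Ux).
apply: Ck_ext (CkD (IH _ _ (Cf a) (CkS Sg)) (IH _ _ (CkS Sf) (Cg a))) => x.
by rewrite inE => Ux; rewrite partialM//; [exact: df|exact: dg].
Qed.

Lemma smooth_diff f x : smooth_on U f -> U x -> differentiable f x.
Proof. by move=> /(_ 1%N) [+ _] => /[apply]. Qed.

Lemma smooth_partial f a : smooth_on U f -> smooth_on U (partial a f).
Proof. by move=> sf k; have [_] := sf k.+1; exact. Qed.

Lemma smooth_ext f g : {in U, f =1 g} -> smooth_on U f -> smooth_on U g.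
Proof. by move=> fg sf k; exact: Ck_ext fg _. Qed.

Lemma smooth_cst (c : R) : smooth_on U (fun=> c).
Proof. by move=> k; exact: Ck_cst. Qed.

Lemma smoothD f g : smooth_on U f -> smooth_on U g -> smooth_on U (fun x => f x + g x).
Proof. by move=> sf sg k; exact: CkD. Qed.

Lemma smoothM f g : smooth_on U f -> smooth_on U g -> smooth_on U (fun x => f x * g x).
Proof. by move=> sf sg k; exact: CkM. Qed.

Lemma smoothN f : smooth_on U f -> smooth_on U (fun x => - f x).
Proof.
move=> sf; have := smoothM (smooth_cst (-1)) sf.
by apply: smooth_ext => x _; rewrite mulN1r.
Qed.

Lemma smooth_sum (I : Type) (r : seq I) (P : pred I) (F : I -> 'rV[R]_n -> R) :
  (forall i, smooth_on U (F i)) ->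
  smooth_on U (fun x => \sum_(i <- r | P i) F i x).
Proof.
move=> sF; elim: r => [|i r IH].
  by under eq_fun do rewrite big_nil; exact: smooth_cst.
under eq_fun do rewrite big_cons; case: (P i) => //; exact: smoothD.
Qed.

Lemma smooth_prod (I : Type) (r : seq I) (P : pred I) (F : I -> 'rV[R]_n -> R) :
  (forall i, smooth_on U (F i)) ->
  smooth_on U (fun x => \prod_(i <- r | P i) F i x).
Proof.
move=> sF; elim: r => [|i r IH].
  by under eq_fun do rewrite big_nil; exact: smooth_cst.
under eq_fun do rewrite big_cons; case: (P i) => //; exact: smoothM.
Qed.

(** Bootstrapping: the derivative of 1/f is a polynomial in 1/f and f', so class C^k of 1/f yields
    class C^(k+1). The exponential works the same way; the logarithm needs no induction, since its
    derivative involves only 1/f and f'. *)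
Lemma smoothV f : (forall x, U x -> f x != 0) ->
  smooth_on U f -> smooth_on U (fun x => (f x)^-1).
Proof.
move=> f0 sf k; have df x (Ux : U x) := smooth_diff sf Ux.
have dV x : U x -> differentiable (fun y => (f y)^-1) x.
  by move=> Ux; apply: differentiableV; [exact: df|exact: f0].
elim: k => [x Ux|k IH]; first exact/differentiable_continuous/dV.
split=> // a; have := CkM (Ck_cst k (-1)) (CkM (CkM IH IH) (smooth_partial a sf k)).
apply: Ck_ext => x; rewrite inE => Ux.
by rewrite mulN1r partialV//; [exact: df|exact: f0].
Qed.

Lemma smooth_expR f : smooth_on U f -> smooth_on U (fun x => expR (f x)).
Proof.
move=> sf k; have pE x a (Ux : U x) := partial_comp a (is_derive_expR (f x)) (smooth_diff sf Ux).
have dE x : U x -> differentiable (fun y => expR (f y)) x.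
  move=> Ux; have dh : differentiable (@expR R) (f x) by exact/derivable1_diffP/derivable_expR.
  exact: differentiable_comp (smooth_diff sf Ux) dh.
elim: k => [x Ux|k IH]; first exact/differentiable_continuous/dE.
split=> // a; have := CkM IH (smooth_partial a sf k).
by apply: Ck_ext => x; rewrite inE => Ux; rewrite (pE x a Ux).2.
Qed.

Lemma smooth_ln f : (forall x, U x -> 0 < f x) ->
  smooth_on U f -> smooth_on U (fun x => ln (f x)).
Proof.
move=> f0 sf.
have pE x a (Ux : U x) := partial_comp a (is_derive1_ln (f0 x Ux)) (smooth_diff sf Ux).
have dE x : U x -> differentiable (fun y => ln (f y)) x.
  move=> Ux; have dh : differentiable (@ln R) (f x).
    by apply/derivable1_diffP; have [] := is_derive1_ln (f0 x Ux).
  exact: differentiable_comp (smooth_diff sf Ux) dh.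
have sV : smooth_on U (fun x => (f x)^-1).
  by apply: smoothV => // x Ux; rewrite gt_eqF// f0.
case=> [x Ux|k]; first exact/differentiable_continuous/dE.
split=> // a; have := CkM (sV k) (smooth_partial a sf k).
by apply: Ck_ext => x; rewrite inE => Ux; rewrite (pE x a Ux).2.
Qed.

End Smooth.

(** * Matrix-valued functions *)

Section MatrixCalculus.
Variables (R : realType) (n : nat).

Definition partial_mx m q (a : 'I_n) (F : 'rV[R]_n -> 'M[R]_(m, q))
  (x : 'rV[R]_n) : 'M[R]_(m, q) := \matrix_(i, j) partial a (fun y => F y i j) x.

Definition diff_mx m q (F : 'rV[R]_n -> 'M[R]_(m, q)) (x : 'rV[R]_n) : Prop :=
  forall i j, differentiable (fun y => F y i j) x.

Definition smooth_mx m q (U : set 'rV[R]_n) (F : 'rV[R]_n -> 'M[R]_(m, q)) : Prop :=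
  forall i j, smooth_on U (fun x => F x i j).

Lemma partial_mx_mul m q r a (F : 'rV[R]_n -> 'M[R]_(m, q))
    (G : 'rV[R]_n -> 'M[R]_(q, r)) x : diff_mx F x -> diff_mx G x ->
  partial_mx a (fun y => F y *m G y) x =
  partial_mx a F x *m G x + F x *m partial_mx a G x.
Proof.
move=> dF dG; apply/matrixP => i j; rewrite !mxE.
under [X in partial _ X]eq_fun do rewrite mxE.
rewrite partial_sum; last by move=> k; exact: differentiableM (dF i k) (dG k j).
rewrite -big_split; apply: eq_bigr => k _.
by rewrite partialM// !mxE.
Qed.

Lemma partial_mxZ m q a (f : 'rV[R]_n -> R) (F : 'rV[R]_n -> 'M[R]_(m, q)) x :
  differentiable f x -> diff_mx F x ->
  partial_mx a (fun y => f y *: F y) x =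
  partial a f x *: F x + f x *: partial_mx a F x.
Proof.
move=> df dF; apply/matrixP => i j; rewrite !mxE.
under [X in partial _ X]eq_fun do rewrite mxE.
by rewrite partialM.
Qed.

Lemma partial_mx_cst m q a (B : 'M[R]_(m, q)) x : partial_mx a (fun=> B) x = 0.
Proof. by apply/matrixP => i j; rewrite !mxE partial_cst. Qed.

Lemma open_eq_partial_mx m q a (U : set 'rV[R]_n) (F G : 'rV[R]_n -> 'M[R]_(m, q)) x :
  open U -> {in U, F =1 G} -> U x -> partial_mx a F x = partial_mx a G x.
Proof.
move=> oU FG Ux; apply/matrixP => i j; rewrite !mxE.
by apply: open_eq_partial oU _ Ux => y /FG ->.
Qed.

Lemma differentiable_det m (F : 'rV[R]_n -> 'M[R]_m) x :
  diff_mx F x -> differentiable (fun y => \det (F y)) x.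
Proof.
move=> dF; apply: differentiable_bigsum => s.
apply: differentiableM; first exact: differentiable_cst.
by apply: differentiable_bigprod => i.
Qed.

(* Jacobi's formula: the i-th term of the Leibniz rule is the determinant of
   [F x] with its i-th row replaced by the derivative, expanded along that row. *)
Lemma partial_det m a (F : 'rV[R]_n -> 'M[R]_m) x : diff_mx F x ->
  partial a (fun y => \det (F y)) x = \tr (\adj (F x) *m partial_mx a F x).
Proof.
move=> dF; pose B i := \matrix_(j, k) (if j == i then partial_mx a F x else F x) j k.
transitivity (\sum_i \det (B i)).
  rewrite [LHS]partial_sum; last first.
    move=> s; apply: differentiableM; first exact: differentiable_cst.
    by apply: differentiable_bigprod => i.
  rewrite exchange_big /=; apply: eq_bigr => s _.
  rewrite partialM ?partial_cst ?mul0r ?add0r; last 2 first.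
  - exact: differentiable_cst.
  - by apply: differentiable_bigprod => i.
  rewrite partial_prod ?index_enum_uniq// big_distrr /=; apply: eq_bigr => i _.
  congr (_ * _); rewrite [RHS](bigD1 i)//= mxE eqxx mxE; congr (_ * _).
  by apply: eq_bigr => j ji; rewrite !mxE (negPf ji).
rewrite mxtrace_mulC; apply: eq_bigr => i _.
rewrite (expand_det_row _ i) mxE; apply: eq_bigr => k _.
rewrite !mxE eqxx mxE; congr (_ * _); rewrite /cofactor; congr (_ * \det _).
by apply/matrixP => u v; rewrite !mxE eq_sym (negPf (neq_lift _ _)).
Qed.

Section SmoothMx.
Variable U : set 'rV[R]_n.
Hypothesis oU : open U.

Lemma smooth_diff_mx m q (F : 'rV[R]_n -> 'M[R]_(m, q)) x :
  smooth_mx U F -> U x -> diff_mx F x.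
Proof. by move=> sF Ux i j; exact: smooth_diff (sF i j) Ux. Qed.

Lemma smooth_mulmx m q r (F : 'rV[R]_n -> 'M[R]_(m, q)) (G : 'rV[R]_n -> 'M[R]_(q, r)) :
  smooth_mx U F -> smooth_mx U G -> smooth_mx U (fun x => F x *m G x).
Proof.
move=> sF sG i j; under eq_fun do rewrite mxE.
by apply: smooth_sum => // k; exact: smoothM.
Qed.

Lemma smooth_scalemx m q f (F : 'rV[R]_n -> 'M[R]_(m, q)) :
  smooth_on U f -> smooth_mx U F -> smooth_mx U (fun x => f x *: F x).
Proof. by move=> sf sF i j; under eq_fun do rewrite mxE; exact: smoothM. Qed.

Lemma smooth_oppmx m q (F : 'rV[R]_n -> 'M[R]_(m, q)) :
  smooth_mx U F -> smooth_mx U (fun x => - F x).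
Proof. by move=> sF i j; under eq_fun do rewrite mxE; exact: smoothN. Qed.

Lemma smooth_det m (F : 'rV[R]_n -> 'M[R]_m) :
  smooth_mx U F -> smooth_on U (fun x => \det (F x)).
Proof.
move=> sF; apply: smooth_sum => // s; apply: smoothM => //; first exact: smooth_cst.
exact: smooth_prod.
Qed.

(** Cramer's rule: each entry is a cofactor divided by a determinant that does not vanish on U. *)
Lemma smooth_invmx m (F : 'rV[R]_n -> 'M[R]_m) :
  (forall x, U x -> F x \in unitmx) ->
  smooth_mx U F -> smooth_mx U (fun x => invmx (F x)).
Proof.
move=> uF sF i j.
have sadj : smooth_on U (fun x => (\adj (F x)) i j).
  under eq_fun do rewrite mxE.
  apply: smoothM => //; first exact: smooth_cst.
  by apply: smooth_det => k l; under eq_fun do rewrite !mxE; exact: sF.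
have d0 x : U x -> \det (F x) != 0 by move=> /uF; rewrite unitmxE unitfE.
apply: (smooth_ext oU _ (smoothM oU (smoothV oU d0 (smooth_det sF)) sadj)).
by move=> x; rewrite inE => /uF ux; rewrite /invmx ux [RHS]mxE.
Qed.

End SmoothMx.
End MatrixCalculus.

(** * Positive definite matrices and pointwise identities *)

Section PosDef.
Variables (R : rcfType) (n : nat).
Implicit Types (S : 'M[R]_n) (v : 'rV[R]_n).

Definition posdef S : Prop := forall v, v != 0 -> 0 < (v *m S *m v^T) 0 0.

Lemma posdef1 : posdef 1%:M.
Proof.
move=> v v0; rewrite mulmx1 mxE.
have sq i : 0 <= v 0 i * v^T i 0 by rewrite mxE -expr2 sqr_ge0.
rewrite lt_def sumr_ge0// andbT psumr_eq0//.
apply: contra v0 => /allP v0; apply/eqP/rowP => i; rewrite mxE.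
by have := v0 i (mem_index_enum _); rewrite mxE /= mulf_eq0 orbb => /eqP.
Qed.

Lemma posdef_unit S : posdef S -> S \in unitmx.
Proof.
move=> pS; rewrite -row_free_unit -kermx_eq0; apply/rowV0P => v /sub_kermxP vS.
by apply/eqP/negPn/negP => /pS; rewrite vS mul0mx mxE ltxx.
Qed.

Lemma posdef_convex S T (t : R) :
  0 <= t <= 1 -> posdef S -> posdef T -> posdef (t *: S + (1 - t) *: T).
Proof.
move=> t01 pS pT v v0; have := pS v v0; have := pT v v0.
rewrite mulmxDr mulmxDl -!scalemxAr -!scalemxAl !mxE.
set x := \sum_j _; set y := \sum_j _ => x0 y0; nra.
Qed.

(* The determinant does not vanish on the segment from 1 to S. *)
Lemma posdef_det_gt0 S : posdef S -> 0 < \det S.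
Proof.
move=> pS; rewrite ltNge; apply/negP => dS.
pose q := \det ('X *: map_mx polyC S + (1 - 'X) *: 1%:M : 'M[{poly R}]_n).
have qE t : q.[t] = \det (t *: S + (1 - t) *: 1%:M).
  rewrite -horner_evalE -det_map_mx; congr (\det _); apply/matrixP => i j.
  by rewrite !mxE /= /horner_eval !hornerE; case: (i == j); rewrite !hornerE.
(* [poly_ivt] wants a value <= 0 at 0 and >= 0 at 1; - q takes the values - 1 and - det S there. *)
have [|t t01] := @poly_ivt R (- q) 0 1 ler01.
  rewrite !hornerN !qE scale0r add0r subr0 scale1r det1 scale1r subrr scale0r addr0.
  by rewrite oppr_ge0 dS andbT oppr_le0 ler01.
rewrite rootN /root qE; apply/negP; rewrite -unitfE -unitmxE.
by apply/posdef_unit/posdef_convex => //; exact: posdef1.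
Qed.

Lemma posdefZ S t : 0 < t -> posdef S -> posdef (t *: S).
Proof. by move=> t0 pS v v0; rewrite -scalemxAr -scalemxAl mxE mulr_gt0// pS. Qed.

(** With w = v S^-1, the form of S^-1 at v is the form of S at w. *)
Lemma posdef_invmx S : S^T = S -> posdef S -> posdef (invmx S).
Proof.
move=> sS pS v v0; have uS := posdef_unit pS.
have vE : v = v *m invmx S *m S by rewrite mulmxKV.
rewrite [in v^T]vE trmx_mul sS mulmxA; apply: pS.
by apply: contraNneq v0 => w0; rewrite vE w0 mul0mx.
Qed.

End PosDef.

Section Algebra.
Variables (R : fieldType) (n : nat).
Implicit Types (S G H Gam : 'M[R]_n) (m Y E : 'rV[R]_n).

Lemma trmx_inv_sym S : S^T = S -> (invmx S)^T = invmx S.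
Proof. by move=> sS; rewrite trmx_inv sS. Qed.

Lemma mulmx1_invE S G : S *m G = 1%:M -> G = invmx S.
Proof.
move=> SG; have [uS _] := mulmx1_unit SG.
by rewrite -[LHS](mulKmx uS) SG mulmx1.
Qed.

(** Here dG and dH stand for the derivatives of a metric and of its inverse. The second hypothesis
    is the derivative of G H = 1 and gives dH = - H dG H, which turns compatibility with lower
    indices into compatibility with upper ones. *)
Lemma compat_inv G H dG dH Gam :
  G *m H = 1%:M -> dG *m H + G *m dH = 0 ->
  dG = Gam *m G + G *m Gam^T -> dH = - (Gam^T *m H + H *m Gam).
Proof.
move=> GH dGH dGE; have HG := mulmx1C GH.
have -> : dH = - (H *m dG *m H).
  have : H *m (G *m dH) = - (H *m dG *m H) by rewrite -(addr0_eq dGH) mulmxN mulmxA.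
  by rewrite mulmxA HG mul1mx.
rewrite dGE mulmxDr mulmxDl -!mulmxA GH mulmx1 !mulmxA HG mul1mx.
by rewrite addrC.
Qed.

Lemma compat_inv_conv G H dG dH Gam :
  H *m G = 1%:M -> dH *m G + H *m dG = 0 ->
  dH = - (Gam^T *m H + H *m Gam) -> dG = Gam *m G + G *m Gam^T.
Proof.
move=> HG dHG dHE.
(* Exchanging upper and lower indices replaces Gam by the dual action - Gam^T. *)
have := @compat_inv H G dH dG (- Gam^T) HG dHG.
rewrite dHE linearN /= trmxK mulNmx mulmxN -opprD => /(_ erefl) ->.
by rewrite mulNmx mulmxN -opprD opprK.
Qed.

(* [Gam + (Y E^T) 1 + Y^T E] is the matrix of a projectively changed connection,
   [E] being the direction of differentiation. *)
Definition projmx Gam Y E := Gam + (Y *m E^T) 0 0 *: 1%:M + Y^T *m E.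

Lemma row_colE (u v : 'rV[R]_n) : u *m v^T = ((u *m v^T) 0 0)%:M.
Proof. by rewrite [LHS]mx11_scalar. Qed.

(** The last bracket has the shape of the right-hand side of the metrisability equation, with Y S in
    place of mu. This is how a projective change absorbs mu, at the cost of the multiple 2 Y_a S. *)
Lemma projmx_act S Gam Y E : S^T = S ->
  (projmx Gam Y E)^T *m S + S *m projmx Gam Y E =
  Gam^T *m S + S *m Gam + ((Y *m E^T) 0 0 *+ 2) *: S
  + (E^T *m (Y *m S) + (Y *m S)^T *m E).
Proof.
move=> sS; rewrite /projmx !linearD /= !linearZ /= trmx1 trmx_mul trmxK.
rewrite !mulmxDl -scalemxAl mul1mx mulmx1.
rewrite (trmx_mul Y S) sS -!mulmxA.
set y := _ 0 0; set A1 := _^T *m S; set A2 := S *m Gam.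
rewrite mulr2n scalerDl.
set B1 := E^T *m _; set B2 := S *m (Y^T *m E); set Z := y *: S.
by rewrite [A1 + Z + B1 + _]addrACA [A1 + Z + _]addrACA.
Qed.

Lemma mxtrace_projmx Gam Y E :
  \tr (projmx Gam Y E) = \tr Gam + (Y *m E^T) 0 0 *+ n.+1.
Proof.
rewrite /projmx !linearD /= linearZ /= mxtrace1 mxtrace_mulC mulr_natr.
rewrite -addrA mulrS [X in _ = _ + X]addrC; congr (_ + (_ + _)).
rewrite -[E *m Y^T]trmxK trmx_mul trmxK mxtrace_tr.
by rewrite [in LHS]row_colE mxtrace_scalar mulr1n.
Qed.

(** By [partial_det] the left-hand side is a derivative of det H. Since adj H commutes with H up to
    the scalar det H, both terms of dH contribute the same trace. *)
Lemma mxtrace_compat H dH Gam : H \in unitmx ->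
  dH = - (Gam^T *m H + H *m Gam) ->
  \tr (\adj H *m dH) = - (\det H * \tr Gam *+ 2).
Proof.
move=> uH ->; rewrite mulmxN linearN /= mulmxDr linearD /= mulmxA.
rewrite mxtrace_mulC !mulmxA mul_mx_adj mul_adj_mx !mul_scalar_mx !linearZ /=.
by rewrite mxtrace_tr mulr2n.
Qed.

End Algebra.

(** * Transition maps *)

Section Charts.
Variables (R : realType) (n : nat) (M : topologicalType) (A : manifold R n M).
Implicit Types (i j k : idx A) (p : M).

Lemma partial_coord (b c : 'I_n) (x : 'rV[R]_n) :
  partial b (fun y => y 0 c) x = (b == c)%:R.
Proof.
pose f := (fun y : 'rV[R]_n => y 0 c).
have flin : linear f by move=> k u v; rewrite /f !mxE.
pose fM := GRing.isLinear.Build _ _ _ _ _ flin.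
pose fL : {linear 'rV[R]_n -> R} := HB.pack f fM.
rewrite /partial deriveE; last exact: differentiable_coord.
rewrite (_ : (fun y : 'rV[R]_n => y 0 c) = fL)// diff_lin; last exact: coord_continuous.
by rewrite /= /f mxE eqxx eq_sym.
Qed.

(** Near a point of the image, continuity of [cinv] pulls U back to a neighbourhood, to be
    intersected with the open image of the whole chart. *)
Lemma img_open i (U : set M) : open U -> open (cmap (A i) @` (U `&` cdom (A i))).
Proof.
move=> oU; rewrite openE => _ [p [Up ip] <-].
have Vp : (cmap (A i) @` cdom (A i)) (cmap (A i) p) by exists p.
have := @cinv_continuous _ _ _ (A i) _ Vp.
move/(_ (U)); rewrite cmapK// => /(_ (open_nbhs_nbhs (conj oU Up))) nU.
have nV := open_nbhs_nbhs (conj (@cimg_open _ _ _ (A i)) Vp).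
have Fx := nbhs_filter (cmap (A i) p).
apply: (@filterS _ _ Fx _ _ _ (@filterI _ _ Fx _ _ nU nV)) => x [/= Ux [q iq qx]].
by exists q => //; split=> //; rewrite -qx cmapK// in Ux.
Qed.

Lemma cmap_setT i : cmap (A i) @` (setT `&` cdom (A i)) = cmap (A i) @` cdom (A i).
Proof. by rewrite setTI. Qed.

Lemma cinvP i x : (cmap (A i) @` cdom (A i)) x ->
  cdom (A i) (cinv (A i) x) /\ cmap (A i) (cinv (A i) x) = x.
Proof. by move=> [p ip <-]; rewrite cmapK. Qed.

(** Rows carry the source coordinate and columns the target one. Vectors are therefore rows acted on
    from the right, and the chain rule multiplies in the order in which the charts are traversed. *)
Definition jacm i j p : 'M[R]_n := \matrix_(b, c) jac i j p b c.

Lemma transition_diff i j p : cdom (A i) p -> cdom (A j) p ->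
  forall c, differentiable (fun x => Defs.coord (A j) c (cinv (A i) x)) (cmap (A i) p).
Proof.
move=> ip jp c; apply: (smooth_diff (charts_smooth i j c)).
by exists p.
Qed.

Lemma jacm_comp i j k p : cdom (A i) p -> cdom (A j) p -> cdom (A k) p ->
  jacm i j p *m jacm j k p = jacm i k p.
Proof.
move=> ip jp kp; apply/matrixP => b c; rewrite !mxE; apply/esym.
(* The transition from i to k factors as [psi \o phi] only on W, where chart j is defined. [phi] is
   written as a sum over coordinates because smoothness of transitions is known coordinate by
   coordinate. *)
pose W := cmap (A i) @` (cdom (A j) `&` cdom (A i)).
pose phi x := \sum_d Defs.coord (A j) d (cinv (A i) x) *: delta_mx 0 d : 'rV[R]_n.
pose psi y := Defs.coord (A k) c (cinv (A j) y).
have phiE x : phi x = cmap (A j) (cinv (A i) x).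
  by rewrite [RHS]row_sum_delta.
have phip : phi (cmap (A i) p) = cmap (A j) p by rewrite phiE cmapK.
have dt := transition_diff ip jp.
have dphi : differentiable phi (cmap (A i) p).
  have -> : phi = \sum_d (fun x => Defs.coord (A j) d (cinv (A i) x) *: delta_mx 0 d).
    by apply/funext => x; rewrite fct_sumE.
  by apply: differentiable_sum => d; exact: differentiableZl.
have dpsi : differentiable psi (phi (cmap (A i) p)).
  by rewrite phip; exact: (transition_diff jp kp).
transitivity (partial b (psi \o phi) (cmap (A i) p)).
  apply: (@open_eq_partial _ _ W); first exact/img_open/cdom_open.
    move=> x; rewrite inE => -[q [jq iq] <-] /=.
    by rewrite /psi phiE cmapK// cmapK.
  by exists p.
have dphiE : 'd phi (cmap (A i) p) (delta_mx 0 b) = \sum_d jac i j p b d *: delta_mx 0 d.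
  rewrite -deriveE// [LHS]row_sum_delta; apply: eq_bigr => d _; congr (_ *: _).
  rewrite derive_mx; last exact: diff_derivable.
  have phid : (fun x => phi x 0 d) = (fun x => Defs.coord (A j) d (cinv (A i) x)).
    by apply/funext => x; rewrite phiE.
  by rewrite mxE phid.
rewrite /partial deriveE; last exact: differentiable_comp.
rewrite diff_comp//= dphiE.
rewrite linear_sum /=; apply: eq_bigr => d _.
rewrite linearZ /= !mxE phip; congr (_ * _).
by rewrite -(deriveE _ (transition_diff jp kp c)).
Qed.

Lemma jacm_id i p : cdom (A i) p -> jacm i i p = 1%:M.
Proof.
move=> ip; apply/matrixP => b c; rewrite !mxE -(partial_coord b c (cmap (A i) p)).
apply: (@open_eq_partial _ _ (cmap (A i) @` cdom (A i))); first exact: cimg_open.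
  by move=> x; rewrite inE => /cinvP [_ {2}<-].
by exists p.
Qed.

Lemma jacm_inv i j p : cdom (A i) p -> cdom (A j) p ->
  jacm i j p *m jacm j i p = 1%:M.
Proof. by move=> ip jp; rewrite jacm_comp// jacm_id. Qed.

Lemma smooth_jacm i j : smooth_mx (cmap (A i) @` (cdom (A i) `&` cdom (A j)))
  (fun x => jacm i j (cinv (A i) x)).
Proof.
move=> b c; have := @img_open i _ (@cdom_open _ _ _ (A j)); rewrite setIC => oW.
have := smooth_partial b (charts_smooth i j c).
apply: smooth_ext => // x; rewrite inE => -[p [ip jp] <-].
by rewrite mxE /jac cmapK.
Qed.

(* The Jacobian of the inverse transition, read in the source chart: being an
   inverse matrix it is smooth without any chain rule of higher order. *)
Lemma smooth_jacm_rev i j : smooth_mx (cmap (A i) @` (cdom (A i) `&` cdom (A j)))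
  (fun x => jacm j i (cinv (A i) x)).
Proof.
have := @img_open i _ (@cdom_open _ _ _ (A j)); rewrite setIC => oW.
have sJ : smooth_mx (cmap (A i) @` (cdom (A i) `&` cdom (A j))) (fun x => invmx (jacm i j (cinv (A i) x))).
  apply: (smooth_invmx oW _ (@smooth_jacm i j)) => x [p [ip jp] <-].
  by rewrite cmapK//; have [] := mulmx1_unit (jacm_inv ip jp).
move=> b c; apply: (smooth_ext oW _ (sJ b c)) => x; rewrite inE => -[p [ip jp] <-].
by rewrite cmapK// -(mulmx1_invE (jacm_inv ip jp)).
Qed.

End Charts.

(** * Tensors as matrices *)

Section FiniteIndices.
Variable n : nat.

Lemma idx0_eta (w : {ffun 'I_0 -> 'I_n}) : w = idx0 n.
Proof. by apply/ffunP => -[]. Qed.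

Lemma idx1_eta (w : {ffun 'I_1 -> 'I_n}) : w = idx1 (w ord0).
Proof. by apply/ffunP => s; rewrite ffunE ord1. Qed.

Lemma idx2_eta (w : {ffun 'I_2 -> 'I_n}) : w = idx2 (w ord0) (w ord_max).
Proof.
apply/ffunP => s; rewrite ffunE; case: eqVneq => [->//|s0].
congr (w _); apply/val_inj => /=.
by case: s s0 => -[|[]].
Qed.

Lemma idx2_0 (b c : 'I_n) : idx2 b c ord0 = b.
Proof. by rewrite ffunE. Qed.

Lemma idx2_1 (b c : 'I_n) : idx2 b c ord_max = c.
Proof. by rewrite ffunE. Qed.

Variable V : nmodType.

Lemma sum_idx0 (F : {ffun 'I_0 -> 'I_n} -> V) : \sum_w F w = F (idx0 n).
Proof. by rewrite (big_pred1 (idx0 n))// => w; rewrite [w]idx0_eta; apply/esym/eqP. Qed.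

Lemma sum_idx1 (F : {ffun 'I_1 -> 'I_n} -> V) : \sum_w F w = \sum_a F (idx1 a).
Proof.
rewrite (reindex (@idx1 n))//; apply: onW_bij.
exists (fun w : {ffun 'I_1 -> 'I_n} => w ord0) => [a|w]; first by rewrite ffunE.
by rewrite -idx1_eta.
Qed.

Lemma sum_idx2 (F : {ffun 'I_2 -> 'I_n} -> V) :
  \sum_w F w = \sum_a \sum_b F (idx2 a b).
Proof.
rewrite pair_big (reindex (fun ab : 'I_n * 'I_n => idx2 ab.1 ab.2))//.
apply: onW_bij; exists (fun w : {ffun 'I_2 -> 'I_n} => (w ord0, w ord_max)).
  by move=> [a b]; rewrite idx2_0 idx2_1.
by move=> w; rewrite -idx2_eta.
Qed.

End FiniteIndices.

(** * Alternating functions of n indices *)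

Section Alternating.
Variables (R : realType) (n : nat) (f : {ffun 'I_n -> 'I_n} -> R).
Hypothesis alt : forall (w : {ffun 'I_n -> 'I_n}) (s : 'S_n),
  f [ffun t => w (s t)] = (-1) ^+ s * f w.

(** Transposing two slots that hold the same index fixes the tuple but flips the sign. *)
Lemma alt_noninj (w : {ffun 'I_n -> 'I_n}) : ~~ injectiveb w -> f w = 0.
Proof.
move=> /injectivePn [a [b ab wab]].
have := alt w (tperm a b); rewrite odd_tperm ab expr1.
have -> : [ffun t => w (tperm a b t)] = w.
  by apply/ffunP => t; rewrite ffunE; case: tpermP => [->|->|].
by rewrite mulN1r => /eqP; rewrite -subr_eq0 opprK -mulr2n mulrn_eq0 => /eqP.
Qed.

Lemma alt_perm (s : 'S_n) : f [ffun t => s t] = (-1) ^+ s * f [ffun t => t].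
Proof. by rewrite -alt; congr f; apply/ffunP => t; rewrite !ffunE. Qed.

(** Only injective tuples survive; they are the permutations, and what remains is the Leibniz
    expansion of the determinant. *)
Lemma alt_det (J : 'M[R]_n) :
  \sum_(w : {ffun 'I_n -> 'I_n}) (\prod_s J s (w s)) * f w =
  \det J * f [ffun t => t].
Proof.
rewrite (bigID (fun w : {ffun 'I_n -> 'I_n} => injectiveb w)) /= addrC big1 ?add0r; last first.
  by move=> w /alt_noninj ->; rewrite mulr0.
rewrite (reindex (@pval _)) /=; last first.
  pose in_Sn := insubd (1%g : 'S_n).
  by exists in_Sn => /= w Uw; first apply: val_inj; apply: insubdK.
rewrite (eq_bigl predT); last by move=> s; rewrite /= (valP s).
rewrite mulr_suml; apply: eq_bigr => s _.
have -> : pval s = [ffun t => s t] by apply/ffunP => t; rewrite ffunE pvalE.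
rewrite alt_perm mulrCA mulrA; congr (_ * _ * _).
by apply: eq_bigr => t _; rewrite ffunE.
Qed.

Lemma alt_id_neq0 : (exists w, f w != 0) -> f [ffun t => t] != 0.
Proof.
move=> [w fw]; have /injectiveP iw : injectiveb w.
  by apply: contraNT fw => /alt_noninj ->.
apply: contraNneq fw => f0.
have := alt_perm (perm iw); rewrite f0 mulr0 => <-; apply/eqP; congr f.
by apply/ffunP => t; rewrite ffunE permE.
Qed.

(** Putting c in slot s repeats an index unless c = s. Hence a connection acts on a volume form
    through its trace alone. *)
Lemma alt_subst (s c : 'I_n) :
  f (subst_idx [ffun t => t] s c) = (s == c)%:R * f [ffun t => t].
Proof.
case: eqVneq => [->|sc].
  by rewrite mul1r; congr f; apply/ffunP => t; rewrite !ffunE; case: eqVneq.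
rewrite mul0r alt_noninj//; apply/injectivePn; exists s, c => //.
by rewrite !ffunE eqxx eq_sym (negPf sc).
Qed.

End Alternating.

Section TensorMatrices.
Variables (R : realType) (n : nat) (M : topologicalType) (A : manifold R n M).
Implicit Types (i j : idx A) (p : M).

Definition up2 (T : components A 2 0) i p : 'M[R]_n :=
  \matrix_(b, c) T i p (idx2 b c) (idx0 n).
Definition lo2 (T : components A 0 2) i p : 'M[R]_n :=
  \matrix_(b, c) T i p (idx0 n) (idx2 b c).
Definition up1 (T : components A 1 0) i p : 'rV[R]_n :=
  \row_c T i p (idx1 c) (idx0 n).
Definition lo1 (T : components A 0 1) i p : 'rV[R]_n :=
  \row_c T i p (idx0 n) (idx1 c).

Lemma tensor_eq k l (T T' : tensor A k l) :
  (forall i p u w, cdom (A i) p -> T i p u w = T' i p u w) -> T = T'.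
Proof.
case: T T' => [T tT oT] [T' tT' oT'] /= TT'.
have TE : T = T'.
  apply/funext => i; apply/funext => p; apply/funext => u; apply/funext => w.
  by have [/TT'//|ip] := pselect (cdom (A i) p); rewrite oT// oT'.
by case: _ / TE in tT' oT' *; congr Tensor; exact: Prop_irrelevance.
Qed.

Lemma up2_inj (T T' : tensor A 2 0) :
  (forall i p, cdom (A i) p -> up2 T i p = up2 T' i p) -> T = T'.
Proof.
move=> TT'; apply: tensor_eq => i p u w /TT' /matrixP /(_ (u ord0) (u ord_max)).
by rewrite !mxE -idx2_eta [w]idx0_eta.
Qed.

Lemma lo2_inj (T T' : tensor A 0 2) :
  (forall i p, cdom (A i) p -> lo2 T i p = lo2 T' i p) -> T = T'.
Proof.
move=> TT'; apply: tensor_eq => i p u w /TT' /matrixP /(_ (w ord0) (w ord_max)).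
by rewrite !mxE -idx2_eta [u]idx0_eta.
Qed.

Lemma up2_smooth (T : tensor A 2 0) i :
  smooth_mx (cmap (A i) @` cdom (A i)) (fun x => up2 T i (cinv (A i) x)).
Proof.
have [+ _] := tensorP T; move=> sT b c; have := sT i (idx2 b c) (idx0 n).
by rewrite cmap_setT; under [X in _ -> smooth_on _ X]eq_fun do rewrite mxE.
Qed.

Lemma lo2_smooth (T : tensor A 0 2) i :
  smooth_mx (cmap (A i) @` cdom (A i)) (fun x => lo2 T i (cinv (A i) x)).
Proof.
have [+ _] := tensorP T; move=> sT b c; have := sT i (idx0 n) (idx2 b c).
by rewrite cmap_setT; under [X in _ -> smooth_on _ X]eq_fun do rewrite mxE.
Qed.

Lemma up1_smooth (T : tensor A 1 0) i :
  smooth_mx (cmap (A i) @` cdom (A i)) (fun x => up1 T i (cinv (A i) x)).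
Proof.
have [+ _] := tensorP T; move=> sT b c; have := sT i (idx1 c) (idx0 n).
by rewrite cmap_setT; under [X in _ -> smooth_on _ X]eq_fun do rewrite mxE.
Qed.

Lemma lo1_smooth (T : tensor A 0 1) i :
  smooth_mx (cmap (A i) @` cdom (A i)) (fun x => lo1 T i (cinv (A i) x)).
Proof.
have [+ _] := tensorP T; move=> sT b c; have := sT i (idx0 n) (idx1 c).
by rewrite cmap_setT; under [X in _ -> smooth_on _ X]eq_fun do rewrite mxE.
Qed.

Lemma up2_change (T : tensor A 2 0) i j p : cdom (A i) p -> cdom (A j) p ->
  up2 T j p = (jacm i j p)^T *m up2 T i p *m jacm i j p.
Proof.
move=> ip jp; have [_ cT] := tensorP T; apply/matrixP => b c.
rewrite !mxE (cT i j)// sum_idx2.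
under [RHS]eq_bigr => b' _ do rewrite mxE mulr_suml.
rewrite exchange_big /=; apply: eq_bigr => b' _; apply: eq_bigr => c' _.
rewrite sum_idx0 big_ord0 mulr1 !big_ord_recl big_ord0 mulr1 !ffunE /= !mxE.
by rewrite mulrAC.
Qed.

Lemma lo2_change (T : tensor A 0 2) i j p : cdom (A i) p -> cdom (A j) p ->
  lo2 T j p = jacm j i p *m lo2 T i p *m (jacm j i p)^T.
Proof.
move=> ip jp; have [_ cT] := tensorP T; apply/matrixP => b c.
rewrite !mxE (cT i j)// sum_idx0 sum_idx2.
under [RHS]eq_bigr => b' _ do rewrite mxE mulr_suml.
rewrite exchange_big /=; apply: eq_bigr => b' _; apply: eq_bigr => c' _.
rewrite big_ord0 mul1r !big_ord_recl big_ord0 mulr1 !ffunE /= !mxE.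
by rewrite mulrAC.
Qed.

Lemma up1_change (T : tensor A 1 0) i j p : cdom (A i) p -> cdom (A j) p ->
  up1 T j p = up1 T i p *m jacm i j p.
Proof.
move=> ip jp; have [_ cT] := tensorP T; apply/matrixP => b c.
rewrite !mxE (cT i j)// sum_idx1; apply: eq_bigr => b' _.
by rewrite sum_idx0 big_ord0 mulr1 big_ord_recl big_ord0 mulr1 !ffunE !mxE mulrC.
Qed.

Lemma lo1_change (T : tensor A 0 1) i j p : cdom (A i) p -> cdom (A j) p ->
  lo1 T j p = lo1 T i p *m (jacm j i p)^T.
Proof.
move=> ip jp; have [_ cT] := tensorP T; apply/matrixP => b c.
rewrite !mxE (cT i j)// sum_idx0 sum_idx1; apply: eq_bigr => b' _.
by rewrite big_ord0 mul1r big_ord_recl big_ord0 mulr1 !ffunE !mxE mulrC.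
Qed.

(** Extension by a default value, which provides the vanishing demanded by [tensor_out] and
    [christoffel_out]. *)
Definition on_chart (T : Type) (z : T) (F : idx A -> M -> T) i p : T :=
  if `[< cdom (A i) p >] then F i p else z.

Lemma on_chartE (T : Type) (z : T) F i p : cdom (A i) p -> on_chart z F i p = F i p.
Proof. by move=> ip; rewrite /on_chart; case: asboolP. Qed.

Lemma on_chart_out (T : Type) (z : T) F i p : ~ cdom (A i) p -> on_chart z F i p = z.
Proof. by move=> ip; rewrite /on_chart; case: asboolP. Qed.

Lemma smooth_on_chart (f : idx A -> M -> R) i (U : set M) : open U ->
  smooth_on (cmap (A i) @` (U `&` cdom (A i))) (fun x => f i (cinv (A i) x)) ->
  smooth_on (cmap (A i) @` (U `&` cdom (A i))) (fun x => on_chart 0 f i (cinv (A i) x)).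
Proof.
move=> oU; apply: smooth_ext; first exact: img_open.
by move=> x; rewrite inE => -[p [Up ip] <-]; rewrite cmapK// on_chartE.
Qed.

Lemma ex_up2 (F : idx A -> M -> 'M[R]_n) :
  (forall i, smooth_mx (cmap (A i) @` cdom (A i)) (fun x => F i (cinv (A i) x))) ->
  (forall i j p, cdom (A i) p -> cdom (A j) p ->
    F j p = (jacm i j p)^T *m F i p *m jacm i j p) ->
  exists T : tensor A 2 0, forall i p, cdom (A i) p -> up2 T i p = F i p.
Proof.
move=> sF cF; pose T : components A 2 0 := fun i p u _ =>
  on_chart 0 (fun i p => F i p (u ord0) (u ord_max)) i p.
have tT : tensor_on setT T.
  split=> [i u w|i j p _ ip jp u w].
    apply: (smooth_on_chart (f := fun i p => F i p (u ord0) (u ord_max))).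
      exact: openT.
    by rewrite cmap_setT; exact: sF.
  rewrite /T on_chartE// (cF i j)// !mxE sum_idx2.
  under [LHS]eq_bigr => b' _ do rewrite mxE mulr_suml.
  rewrite exchange_big /=; apply: eq_bigr => b' _; apply: eq_bigr => c' _.
  rewrite sum_idx0 on_chartE// big_ord0 mulr1 !big_ord_recl big_ord0 mulr1 !ffunE /= !mxE.
  by rewrite mulrAC (_ : lift _ _ = ord_max)//; apply/val_inj.
have oT i p u w : ~ cdom (A i) p -> T i p u w = 0 by exact: on_chart_out.
exists (Tensor tT oT) => i p ip; apply/matrixP => b c.
by rewrite mxE /= /T on_chartE// idx2_0 idx2_1.
Qed.

Lemma ex_lo2 (F : idx A -> M -> 'M[R]_n) :
  (forall i, smooth_mx (cmap (A i) @` cdom (A i)) (fun x => F i (cinv (A i) x))) ->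
  (forall i j p, cdom (A i) p -> cdom (A j) p ->
    F j p = jacm j i p *m F i p *m (jacm j i p)^T) ->
  exists T : tensor A 0 2, forall i p, cdom (A i) p -> lo2 T i p = F i p.
Proof.
move=> sF cF; pose T : components A 0 2 := fun i p _ w =>
  on_chart 0 (fun i p => F i p (w ord0) (w ord_max)) i p.
have tT : tensor_on setT T.
  split=> [i u w|i j p _ ip jp u w].
    apply: (smooth_on_chart (f := fun i p => F i p (w ord0) (w ord_max))).
      exact: openT.
    by rewrite cmap_setT; exact: sF.
  rewrite /T on_chartE// (cF i j)// !mxE sum_idx0 sum_idx2.
  under [LHS]eq_bigr => b' _ do rewrite mxE mulr_suml.
  rewrite exchange_big /=; apply: eq_bigr => b' _; apply: eq_bigr => c' _.
  rewrite on_chartE// big_ord0 mul1r !big_ord_recl big_ord0 mulr1 !ffunE /= !mxE.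
  by rewrite mulrAC (_ : lift _ _ = ord_max)//; apply/val_inj.
have oT i p u w : ~ cdom (A i) p -> T i p u w = 0 by exact: on_chart_out.
exists (Tensor tT oT) => i p ip; apply/matrixP => b c.
by rewrite mxE /= /T on_chartE// idx2_0 idx2_1.
Qed.

(** The field lives only on U: projective equivalence is tested on locally defined vector fields.
    With [U = setT] the first and last conclusions are the two fields of a [tensor]. *)
Lemma ex_up1 (U : set M) (F : idx A -> M -> 'rV[R]_n) : open U ->
  (forall i, smooth_mx (cmap (A i) @` (U `&` cdom (A i))) (fun x => F i (cinv (A i) x))) ->
  (forall i j p, U p -> cdom (A i) p -> cdom (A j) p -> F j p = F i p *m jacm i j p) ->
  exists T : components A 1 0, [/\ tensor_on U T,
    forall i p, cdom (A i) p -> up1 T i p = F i p &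
    forall i p u w, ~ cdom (A i) p -> T i p u w = 0].
Proof.
move=> oU sF cF; pose T : components A 1 0 := fun i p u _ =>
  on_chart 0 (fun i p => F i p 0 (u ord0)) i p.
exists T; split; last by move=> i p u w; exact: on_chart_out.
  split=> [i u w|i j p Up ip jp u w].
    by apply: (smooth_on_chart (f := fun i p => F i p 0 (u ord0))) => //; exact: sF.
  rewrite /T on_chartE// (cF i j)// !mxE sum_idx1; apply: eq_bigr => b' _.
  by rewrite sum_idx0 on_chartE// big_ord0 mulr1 big_ord_recl big_ord0 mulr1 !ffunE !mxE mulrC.
by move=> i p ip; apply/rowP => c; rewrite !mxE /T on_chartE// ffunE.
Qed.

Lemma ex_lo1 (F : idx A -> M -> 'rV[R]_n) :
  (forall i, smooth_mx (cmap (A i) @` cdom (A i)) (fun x => F i (cinv (A i) x))) ->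
  (forall i j p, cdom (A i) p -> cdom (A j) p -> F j p = F i p *m (jacm j i p)^T) ->
  exists T : tensor A 0 1, forall i p, cdom (A i) p -> lo1 T i p = F i p.
Proof.
move=> sF cF; pose T : components A 0 1 := fun i p _ w =>
  on_chart 0 (fun i p => F i p 0 (w ord0)) i p.
have tT : tensor_on setT T.
  split=> [i u w|i j p _ ip jp u w].
    apply: (smooth_on_chart (f := fun i p => F i p 0 (w ord0))); first exact: openT.
    by rewrite cmap_setT; exact: sF.
  rewrite /T on_chartE// (cF i j)// !mxE sum_idx0 sum_idx1; apply: eq_bigr => b' _.
  by rewrite on_chartE// big_ord0 mul1r big_ord_recl big_ord0 mulr1 !ffunE !mxE mulrC.
have oT i p u w : ~ cdom (A i) p -> T i p u w = 0 by exact: on_chart_out.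
exists (Tensor tT oT) => i p ip; apply/rowP => c.
by rewrite mxE /= /T on_chartE// ffunE.
Qed.

End TensorMatrices.

(** * Connections *)

Section Connections.
Variables (R : realType) (n : nat) (M : topologicalType) (A : manifold R n M).
Implicit Types (i j : idx A) (p : M) (D : connection A).

(** The direction a is set apart; rows carry the lower index and columns the upper one. On row
    vectors nabla_a X is then d_a X + X Gam_a. *)
Definition gam D i p (a : 'I_n) : 'M[R]_n := \matrix_(b, c) christoffel D i p a b c.

Definition unit_rV (a : 'I_n) : 'rV[R]_n := delta_mx 0 a.

Lemma addmx_apply m q (B C : 'M[R]_(m, q)) b c : (B + C) b c = B b c + C b c.
Proof. by rewrite mxE. Qed.

Lemma submx_apply m q (B C : 'M[R]_(m, q)) b c : (B - C) b c = B b c - C b c.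
Proof. by rewrite !mxE. Qed.

Lemma subst_idx2_0 (b c d : 'I_n) : subst_idx (idx2 b c) ord0 d = idx2 d c.
Proof. by apply/ffunP => s; rewrite !ffunE; case: eqP. Qed.

Lemma subst_idx2_1 (b c d : 'I_n) : subst_idx (idx2 b c) (lift ord0 ord0) d = idx2 b d.
Proof. by apply/ffunP => -[[|[|]]//= ?]; rewrite !ffunE. Qed.

Lemma subst_idx1 (b d : 'I_n) : subst_idx (idx1 b) ord0 d = idx1 d.
Proof. by apply/ffunP => s; rewrite !ffunE ord1. Qed.

Lemma idx2_lift (b c : 'I_n) : idx2 b c (lift ord0 ord0) = c.
Proof. by rewrite ffunE. Qed.

Lemma covD_up2 D (T : components A 2 0) i p a b c :
  covD D T i p a (idx2 b c) (idx0 n) =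
  (partial_mx a (fun x => up2 T i (cinv (A i) x)) (cmap (A i) p)
   + ((gam D i p a)^T *m up2 T i p + up2 T i p *m gam D i p a)) b c.
Proof.
rewrite /covD big_ord0 subr0 !big_ord_recl big_ord0 addr0 !mxE; congr (_ + (_ + _)).
- by congr partial; apply/funext => x; rewrite mxE.
- by apply: eq_bigr => d _; rewrite subst_idx2_0 idx2_0 !mxE.
- by apply: eq_bigr => d _; rewrite subst_idx2_1 idx2_lift !mxE mulrC.
Qed.

Lemma covD_lo2 D (T : components A 0 2) i p a b c :
  covD D T i p a (idx0 n) (idx2 b c) =
  (partial_mx a (fun x => lo2 T i (cinv (A i) x)) (cmap (A i) p)
   - (gam D i p a *m lo2 T i p + lo2 T i p *m (gam D i p a)^T)) b c.
Proof.
rewrite /covD big_ord0 addr0 !big_ord_recl big_ord0 addr0 !mxE; congr (_ - (_ + _)).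
- by congr partial; apply/funext => x; rewrite mxE.
- by apply: eq_bigr => d _; rewrite subst_idx2_0 idx2_0 !mxE.
- by apply: eq_bigr => d _; rewrite subst_idx2_1 idx2_lift !mxE mulrC.
Qed.

Lemma covD_up1 D (X : components A 1 0) i p a b :
  covD D X i p a (idx1 b) (idx0 n) =
  partial a (fun x => X i (cinv (A i) x) (idx1 b) (idx0 n)) (cmap (A i) p)
  + (up1 X i p *m gam D i p a) 0 b.
Proof.
rewrite /covD big_ord0 subr0 big_ord_recl big_ord0 addr0 !mxE; congr (_ + _).
by apply: eq_bigr => d _; rewrite subst_idx1 ffunE !mxE mulrC.
Qed.

Lemma projmxE (Gam : 'M[R]_n) (Y : 'rV[R]_n) a b c :
  projmx Gam Y (unit_rV a) b c = Gam b c + Y 0 a * (b == c)%:R + Y 0 b * (a == c)%:R.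
Proof.
rewrite /projmx /unit_rV trmx_delta -colE !mxE big_ord1 !mxE eqxx /= [c == a]eq_sym.
by rewrite mulr_natr.
Qed.

Lemma projectively_equivalentP D D' :
  projectively_equivalent D D' <->
  exists Y : tensor A 0 1, forall i p, cdom (A i) p -> forall a,
    gam D' i p a = projmx (gam D i p a) (lo1 Y i p) (unit_rV a).
Proof.
split=> -[Y hY]; exists Y; last first.
  move=> U X oU tX i p Up ip a b; rewrite !covD_up1 hY// -!addrA; congr (_ + _).
  rewrite /projmx !mulmxDr -scalemxAr mulmx1 !addmx_apply -addrA; congr (_ + (_ + _)).
    by rewrite /unit_rV trmx_delta -colE !mxE.
  rewrite mulmxA /unit_rV !mxE big_ord1 !mxE eqxx /= mulrC /delta [b == a]eq_sym.
  by congr (_ * _); apply: eq_bigr => c _; rewrite !mxE mulrC.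
move=> i p ip a; apply/matrixP => b c.
pose U := cdom (A i); have oU : open U by exact: cdom_open.
(* Components in chart j of the b-th coordinate vector field of chart i. Testing on it isolates row
   b of the connection matrix. *)
pose F j q := row b (jacm i j q).
have [||X [tX XE _]] := @ex_up1 _ _ _ A U F oU.
- move=> j k l; under eq_fun do rewrite mxE; rewrite /U setIC.
  exact: (@smooth_jacm_rev _ _ _ A j i).
- by move=> j k q iq jq kq; rewrite /F -row_mul jacm_comp.
have := hY U X oU tX i p ip ip a c; rewrite !covD_up1 -!addrA => /addrI.
have XiE : up1 X i p = delta_mx 0 b by rewrite XE// /F jacm_id// row1.
rewrite XiE -!rowE projmxE.
have XE' d : X i p (idx1 d) (idx0 n) = (b == d)%:R.
  by have /rowP/(_ d) := XiE; rewrite !mxE eqxx /= eq_sym.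
rewrite XE' [X in X = _]mxE [in RHS]mxE => ->; rewrite -addrA; congr (_ + (_ + _)).
  by rewrite mxE.
rewrite mulrC mxE (bigD1 b)//= big1 => [|d db]; last by rewrite XE' eq_sym (negPf db) mulr0.
by rewrite XE' eqxx mulr1 addr0.
Qed.

(** The second-derivative term in the transformation law comes from D alone; the added terms in Y
    transform as a tensor. *)
Lemma ex_projective_change D (Y : tensor A 0 1) : exists D', forall i p,
  cdom (A i) p -> forall a,
  gam D' i p a = projmx (gam D i p a) (lo1 Y i p) (unit_rV a).
Proof.
pose C i p a b c := on_chart 0 (fun i p =>
  projmx (gam D i p a) (lo1 Y i p) (unit_rV a) b c) i p.
have CE i p a b c : cdom (A i) p -> C i p a b c =
    christoffel D i p a b c + lo1 Y i p 0 a * (b == c)%:R + lo1 Y i p 0 b * (a == c)%:R.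
  by move=> ip; rewrite /C on_chartE// projmxE mxE.
have sC i a b c : smooth_on (cmap (A i) @` cdom (A i))
    (fun x => C i (cinv (A i) x) a b c).
  have oV := @cimg_open _ _ _ (A i).
  have sY := @lo1_smooth _ _ _ A Y i 0.
  apply: (@smooth_ext _ _ _ oV (fun x => christoffel D i (cinv (A i) x) a b c +
     lo1 Y i (cinv (A i) x) 0 a * (b == c)%:R + lo1 Y i (cinv (A i) x) 0 b * (a == c)%:R)).
    by move=> x; rewrite inE => -[p ip <-]; rewrite cmapK// CE.
  apply: smoothD => //; last by apply: smoothM => //; exact: smooth_cst.
  apply: smoothD => //; first exact: christoffel_smooth.
  by apply: smoothM => //; exact: smooth_cst.
have chC i j p : cdom (A i) p -> cdom (A j) p -> forall a b d,
    \sum_c C i p a b c * jac i j p c d = hess i j p a b d +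
    \sum_e \sum_f C j p e f d * jac i j p a e * jac i j p b f.
  move=> ip jp a b d.
  have YE a' : lo1 Y i p 0 a' = \sum_e lo1 Y j p 0 e * jac i j p a' e.
    by rewrite (lo1_change Y jp ip) mxE; apply: eq_bigr => e _; rewrite !mxE.
  have sumd (F : 'I_n -> R) e : \sum_c (c == e)%:R * F c = F e.
    rewrite (bigD1 e)//= big1 ?addr0 ?eqxx ?mul1r// => c ce.
    by rewrite (negPf ce) mul0r.
  transitivity (\sum_c (christoffel D i p a b c * jac i j p c d +
      ((c == b)%:R * (lo1 Y i p 0 a * jac i j p c d) +
       (c == a)%:R * (lo1 Y i p 0 b * jac i j p c d)))).
    by apply: eq_bigr => c _; rewrite CE// ![c == _]eq_sym; ring.
  rewrite !big_split /= !sumd (christoffel_change _ ip jp) -[LHS]addrA; congr (_ + _).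
  transitivity (\sum_e (\sum_f christoffel D j p e f d * jac i j p a e * jac i j p b f +
      (\sum_f (f == d)%:R * (lo1 Y j p 0 e * jac i j p a e * jac i j p b f) +
       (e == d)%:R * \sum_f jac i j p a e * (lo1 Y j p 0 f * jac i j p b f)))); last first.
    apply: eq_bigr => e _; rewrite mulr_sumr -!big_split; apply: eq_bigr => f _.
    by rewrite CE//=; ring.
  rewrite !big_split /= sumd -mulr_sumr -YE [in RHS]mulrC; congr (_ + (_ + _)).
  by rewrite YE mulr_suml; apply: eq_bigr => e _; rewrite sumd.
have oC i p a b c : ~ cdom (A i) p -> C i p a b c = 0 by exact: on_chart_out.
exists (Connection sC chC oC) => i p ip a; apply/matrixP => b c.
by rewrite [LHS]mxE; exact: on_chartE.
Qed.

Lemma torsion_freeE D : torsion_free D <->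
  forall i p, cdom (A i) p -> forall a b c, gam D i p a b c = gam D i p b a c.
Proof.
split=> tD i p ip a b c; first by rewrite !mxE tD.
by have := tD i p ip a b c; rewrite !mxE.
Qed.

Lemma connection_eq D D' :
  (forall i p, cdom (A i) p -> forall a, gam D i p a = gam D' i p a) -> D = D'.
Proof.
move=> DD'; have CE : christoffel D = christoffel D'.
  apply/funext => i; apply/funext => p; apply/funext => a.
  apply/funext => b; apply/funext => c.
  have [ip|ip] := pselect (cdom (A i) p); last by rewrite !christoffel_out.
  by have /matrixP/(_ b c) := DD' i p ip a; rewrite !mxE.
case: D D' CE {DD'} => [C s1 c1 o1] [C' s2 c2 o2] /= CE.
by case: _ / CE in s2 c2 o2 *; congr Connection; exact: Prop_irrelevance.
Qed.

Lemma metric_connection_eq (t t' : metric_connection A) :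
  mc_metric t = mc_metric t' -> mc_conn t = mc_conn t' -> t = t'.
Proof.
case: t t' => [g D r l] [g' D' r' l'] /= gg DD.
case: _ / gg in r' l' *; case: _ / DD in l' *.
by congr MetricConnection; exact: Prop_irrelevance.
Qed.

Definition compatible D (g : tensor A 0 2) : Prop := forall i p, cdom (A i) p -> forall a,
  partial_mx a (fun x => lo2 g i (cinv (A i) x)) (cmap (A i) p) =
  gam D i p a *m lo2 g i p + lo2 g i p *m (gam D i p a)^T.

Lemma levi_civitaE (g : tensor A 0 2) D :
  levi_civita g D <-> torsion_free D /\ compatible D g.
Proof.
split=> -[tD cD]; split=> // i p ip a.
  by apply/eqP; rewrite -subr_eq0; apply/eqP/matrixP => b c; rewrite -covD_lo2 cD// mxE.
by move=> b c; rewrite covD_lo2 cD// subrr mxE.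
Qed.

(* Lowering the last index of the difference of two Levi-Civita connections gives
   a 3-tensor symmetric in the first pair and skew in the last one. *)
Lemma levi_civita_unique (g : tensor A 0 2) D D' :
  (forall i p, cdom (A i) p -> lo2 g i p \in unitmx /\ (lo2 g i p)^T = lo2 g i p) ->
  levi_civita g D -> levi_civita g D' -> D = D'.
Proof.
move=> ug /levi_civitaE [tD cD] /levi_civitaE [tD' cD'].
apply: connection_eq => i p ip; have [uG sG] := ug i p ip.
pose G := lo2 g i p; pose B a := (gam D i p a - gam D' i p a) *m G.
have Bskew a : B a = - (B a)^T.
  have e := cD i p ip a; rewrite (cD' i p ip a) in e.
  rewrite /B trmx_mul sG linearB /= mulmxBl mulmxBr opprB.
  by apply/eqP; rewrite subr_eq addrAC eq_sym subr_eq addrC e.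
have Bsym a b c : B a b c = B b a c.
  have sym D0 : torsion_free D0 -> (gam D0 i p a *m G) b c = (gam D0 i p b *m G) a c.
    move=> /torsion_freeE t0; rewrite [LHS]mxE [RHS]mxE.
    by apply: eq_bigr => d _; rewrite t0.
  by rewrite /B !mulmxBl !submx_apply !sym.
have Bsk a b c : B a b c = - B a c b by have /matrixP/(_ b c) := Bskew a; rewrite !mxE.
move=> a; apply/eqP; rewrite -subr_eq0; apply/eqP.
rewrite -[LHS](mulmxK uG) -/G -/(B a).
suff -> : B a = 0 by rewrite mul0mx.
apply/matrixP => b c; rewrite [RHS]mxE; apply/eqP.
have : B a b c = - B a b c.
  (* The swaps run through abc, acb, cab, cba, bca, bac, abc, alternately skew and symmetric, so
     three signs accumulate. *)
  by rewrite {1}Bsk Bsym Bsk opprK Bsym Bsk Bsym.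
by move/eqP; rewrite -subr_eq0 opprK -mulr2n mulrn_eq0.
Qed.

End Connections.

(** * Densities *)

Section Metrisability.
Variables (R : realType) (n : nat) (M : topologicalType) (A : manifold R n M).
Implicit Types (i j : idx A) (p : M).
Variables (D : connection A) (e : tensor A 0 n).
Hypotheses (tD : torsion_free D) (ve : volume_form e).
Hypothesis De : forall i p, cdom (A i) p -> forall a w, covD D e i p a (idx0 n) w = 0.

Definition vol i p : R := e i p (idx0 n) [ffun t => t].

Lemma vol_change i j p : cdom (A i) p -> cdom (A j) p ->
  vol j p = \det (jacm j i p) * vol i p.
Proof.
move=> ip jp; have [_ cT] := tensorP e; have [alt _] := ve.
rewrite /vol (cT i j)// sum_idx0 -(alt_det (alt i p ip)); apply: eq_bigr => w _.
rewrite big_ord0 mul1r; congr (_ * _); apply: eq_bigr => s _.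
by rewrite ffunE mxE.
Qed.

Lemma vol_neq0 i p : cdom (A i) p -> vol i p != 0.
Proof. by move=> ip; have [alt nz] := ve; apply: alt_id_neq0 (alt i p ip) (nz i p ip). Qed.

Lemma vol_smooth i : smooth_on (cmap (A i) @` cdom (A i)) (fun x => vol i (cinv (A i) x)).
Proof. by have [+ _] := tensorP e; move=> /(_ i (idx0 n) [ffun t => t]); rewrite cmap_setT. Qed.

(** This is nabla e = 0 for the component e_(1...n): of each sum over c only c = s survives, leaving
    the trace. *)
Lemma vol_partial i p a : cdom (A i) p ->
  partial a (fun x => vol i (cinv (A i) x)) (cmap (A i) p) = \tr (gam D i p a) * vol i p.
Proof.
move=> ip; have [alt _] := ve; have := De ip a [ffun t => t].
rewrite /covD big_ord0 addr0 => /eqP; rewrite subr_eq0 => /eqP ->.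
rewrite /mxtrace mulr_suml; apply: eq_bigr => s _.
rewrite (bigD1 s)//= big1 ?addr0 => [|c cs].
  by rewrite (alt_subst (alt i p ip)) eqxx mul1r ffunE mxE.
by rewrite (alt_subst (alt i p ip)) eq_sym (negPf cs) mul0r mulr0.
Qed.

(** Up to the constant n!, the contraction of n copies of S with two copies of [e], in the chart i.
    The matrix S is an argument so that both sigma and g^-1 can be inserted. *)
Definition density i p (S : 'M[R]_n) : R := vol i p * vol i p * \det S.

Lemma density_gt0 i p S : cdom (A i) p -> 0 < \det S -> 0 < density i p S.
Proof.
move=> ip dS; rewrite /density mulr_gt0// -expr2 exprn_even_gt0//=.
exact: vol_neq0.
Qed.

Lemma densityZ i p t S : density i p (t *: S) = t ^+ n * density i p S.
Proof. by rewrite /density detZ mulrCA. Qed.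

(** The squared Jacobian determinant gained by det S is cancelled by the two factors [vol], so the
    density is a scalar function on M. *)
Lemma density_change i j p S : cdom (A i) p -> cdom (A j) p ->
  density j p ((jacm i j p)^T *m S *m jacm i j p) = density i p S.
Proof.
move=> ip jp; rewrite /density (vol_change ip jp) !det_mulmx det_tr.
have JJ : \det (jacm i j p) * \det (jacm j i p) = 1.
  by rewrite -det_mulmx jacm_inv// det1.
transitivity (vol i p * vol i p * \det S * (\det (jacm i j p) * \det (jacm j i p)) ^+ 2).
  by ring.
by rewrite JJ expr1n mulr1.
Qed.

Lemma density_smooth i (F : 'rV[R]_n -> 'M[R]_n) :
  smooth_mx (cmap (A i) @` cdom (A i)) F ->
  smooth_on (cmap (A i) @` cdom (A i)) (fun x => density i (cinv (A i) x) (F x)).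
Proof.
have oV := @cimg_open _ _ _ (A i); have sv := @vol_smooth i.
by move=> sF; apply: smoothM => //; [exact: smoothM|exact: smooth_det].
Qed.

Lemma density_partial i p a (F : 'rV[R]_n -> 'M[R]_n) :
  smooth_mx (cmap (A i) @` cdom (A i)) F -> cdom (A i) p ->
  let x := cmap (A i) p in
  partial a (fun y => density i (cinv (A i) y) (F y)) x =
  density i p (F x) * (\tr (gam D i p a) *+ 2)
  + vol i p * vol i p * \tr (\adj (F x) *m partial_mx a F x).
Proof.
move=> sF ip x; have Vx : (cmap (A i) @` cdom (A i)) x by exists p.
have dv := smooth_diff (@vol_smooth i) Vx.
have dF := smooth_diff_mx sF Vx.
rewrite /density partialM; [|exact: (differentiableM dv dv)|exact: differentiable_det].
rewrite partial_det// partialM// vol_partial// /x cmapK//.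
by ring.
Qed.

(* [g^ab = (det s) s^ab], the determinant being taken with the volume form [e]. *)
Definition metric_of (s : tensor A 2 0) (g : tensor A 0 2) : Prop :=
  forall i p, cdom (A i) p ->
  (density i p (up2 s i p) *: up2 s i p) *m lo2 g i p = 1%:M.

Lemma quadE (S : 'M[R]_n) (v : 'rV[R]_n) :
  (v *m S *m v^T) 0 0 = \sum_b \sum_c S b c * v 0 b * v 0 c.
Proof.
rewrite mxE exchange_big; apply: eq_bigr => c _ /=.
rewrite mxE mulr_suml; apply: eq_bigr => b _; rewrite mxE; ring.
Qed.

Lemma posdef_contravariantE (s : tensor A 2 0) :
  posdef_contravariant s <->
  forall i p, cdom (A i) p -> (up2 s i p)^T = up2 s i p /\ posdef (up2 s i p).
Proof.
have qE i p (v : 'rV[R]_n) : \sum_b \sum_c s i p (idx2 b c) (idx0 n) * v 0 b * v 0 c =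
    (v *m up2 s i p *m v^T) 0 0.
  by rewrite quadE; apply: eq_bigr => b _; apply: eq_bigr => c _; rewrite mxE.
split=> hs i p ip; have [sy po] := hs i p ip; split.
- by apply/matrixP => b c; rewrite !mxE sy.
- by move=> v /po; rewrite qE.
- by move=> b c; have /matrixP/(_ b c) := sy; rewrite !mxE.
- by move=> v /po; rewrite qE.
Qed.

Lemma riemannian_metricE (g : tensor A 0 2) :
  riemannian_metric g <->
  forall i p, cdom (A i) p -> (lo2 g i p)^T = lo2 g i p /\ posdef (lo2 g i p).
Proof.
have qE i p (v : 'rV[R]_n) : \sum_b \sum_c g i p (idx0 n) (idx2 b c) * v 0 b * v 0 c =
    (v *m lo2 g i p *m v^T) 0 0.
  by rewrite quadE; apply: eq_bigr => b _; apply: eq_bigr => c _; rewrite mxE.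
split=> hs i p ip; have [sy po] := hs i p ip; split.
- by apply/matrixP => b c; rewrite !mxE sy.
- by move=> v /po; rewrite qE.
- by move=> b c; have /matrixP/(_ b c) := sy; rewrite !mxE.
- by move=> v /po; rewrite qE.
Qed.

Definition metrisability_mx (s : tensor A 2 0) (m : tensor A 1 0) : Prop :=
  forall i p, cdom (A i) p -> forall a,
  partial_mx a (fun x => up2 s i (cinv (A i) x)) (cmap (A i) p)
  + ((gam D i p a)^T *m up2 s i p + up2 s i p *m gam D i p a) =
  (unit_rV R a)^T *m up1 m i p + (up1 m i p)^T *m unit_rV R a.

Lemma metrisability_equationE (s : tensor A 2 0) :
  metrisability_equation D s <-> exists m, metrisability_mx s m.
Proof.
have rE (m : tensor A 1 0) i p a b c :
    ((unit_rV R a)^T *m up1 m i p + (up1 m i p)^T *m unit_rV R a) b c =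
    delta R a b * m i p (idx1 c) (idx0 n) + delta R a c * m i p (idx1 b) (idx0 n).
  rewrite addmx_apply !mxE !big_ord1 !mxE eqxx /= /delta [b == a]eq_sym [c == a]eq_sym.
  by rewrite [_ * (a == c)%:R]mulrC.
split=> -[m hm]; exists m => i p ip a.
  by apply/matrixP => b c; rewrite -covD_up2 hm// rE.
by move=> b c; rewrite covD_up2 hm// rE.
Qed.

(* The left-hand side is the metrisability equation with [mu^b = - Y_c s^cb]. *)
Lemma metrisability_proj (S dS Gam : 'M[R]_n) (Y E : 'rV[R]_n) : S^T = S ->
  dS + (Gam^T *m S + S *m Gam) = E^T *m (- (Y *m S)) + (- (Y *m S))^T *m E <->
  dS = ((Y *m E^T) 0 0 *+ 2) *: S
       - ((projmx Gam Y E)^T *m S + S *m projmx Gam Y E).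
Proof.
move=> sS; rewrite projmx_act// mulmxN linearN /= mulNmx.
rewrite -opprD; set P := _ + S *m Gam; set y := _ *: S; set W := _ + _ *m E.
have -> : y - (P + y + W) = - W - P.
  by rewrite [P + y]addrC -addrA opprD addrA subrr add0r opprD addrC.
by split=> [<-|->]; rewrite ?addrK ?subrK.
Qed.

End Metrisability.

(** With J and K mutually inverse Jacobians: the inverse of a tensor with two upper indices
    transforms with two lower ones. *)
Lemma invmx_congr (R : fieldType) (n : nat) (H J K : 'M[R]_n) :
  H \in unitmx -> J *m K = 1%:M ->
  invmx (J^T *m H *m J) = K *m invmx H *m K^T.
Proof.
move=> uH JK; apply/esym/mulmx1_invE.
rewrite -!mulmxA (mulmxA J K) JK mul1mx (mulmxA H) mulmxV// mul1mx.
by rewrite -trmx_mul (mulmx1C JK) trmx1.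
Qed.

(** * From a solution to a metric connection *)

Section SolutionToMetric.
Variables (R : realType) (n : nat) (M : topologicalType) (A : manifold R n M).
Implicit Types (i j : idx A) (p : M).
Variables (D : connection A) (e : tensor A 0 n).
Hypotheses (tD : torsion_free D) (ve : volume_form e).
Hypothesis De : forall i p, cdom (A i) p -> forall a w, covD D e i p a (idx0 n) w = 0.

Lemma partial_mx_inverse i p a (F G : 'rV[R]_n -> 'M[R]_n) :
  smooth_mx (cmap (A i) @` cdom (A i)) F -> smooth_mx (cmap (A i) @` cdom (A i)) G ->
  (forall q, cdom (A i) q -> F (cmap (A i) q) *m G (cmap (A i) q) = 1%:M) ->
  cdom (A i) p -> let x := cmap (A i) p in
  partial_mx a F x *m G x + F x *m partial_mx a G x = 0.
Proof.
move=> sF sG FG ip x; have Vx : (cmap (A i) @` cdom (A i)) x by exists p.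
rewrite -partial_mx_mul; [|exact: smooth_diff_mx sF Vx|exact: smooth_diff_mx sG Vx].
rewrite -[RHS](partial_mx_cst a 1%:M x).
apply: open_eq_partial_mx (@cimg_open _ _ _ (A i)) _ Vx.
by move=> y; rewrite inE => -[q iq <-]; exact: FG.
Qed.

(** The multiple c F contributes c n, the changed connection contributes - 2 tr Gam - 2 (n+1) Y_a,
    and the two volume factors cancel tr Gam. Both directions use this: c = 2 Y_a for sigma, c = 0
    for g^-1. *)
Lemma density_partial_proj i p a (F : 'rV[R]_n -> 'M[R]_n) (Y : 'rV[R]_n) (c : R) :
  smooth_mx (cmap (A i) @` cdom (A i)) F -> cdom (A i) p ->
  let x := cmap (A i) p in
  let Gam' := projmx (gam D i p a) Y (unit_rV R a) in
  F x \in unitmx ->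
  partial_mx a F x = c *: F x - (Gam'^T *m F x + F x *m Gam') ->
  partial a (fun y => density e i (cinv (A i) y) (F y)) x =
  density e i p (F x) * (c * n%:R - 2 * n.+1%:R * (Y *m (unit_rV R a)^T) 0 0).
Proof.
move=> sF ip x Gam' uF dF; rewrite (density_partial ve De)// -/x dF.
rewrite mulmxDr linearD /= -scalemxAr linearZ /= mul_adj_mx mxtrace_scalar.
rewrite (mxtrace_compat uF (erefl _)) mxtrace_projmx /density.
set y := (_ *m _) 0 0; set d := \det _; set t := \tr _.
rewrite -(mulr_natr y) -(mulr_natr d) -(natr1 n) !mulr2n.
move: (n%:R : R) (vol e i p) => N v; ring.
Qed.

Lemma solution_metric (s : tensor A 2 0) :
  posdef_contravariant s -> metrisability_equation D s ->
  exists t : metric_connection A,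
    projectively_equivalent D t /\ metric_of e s (mc_metric t).
Proof.
move=> /posdef_contravariantE ps /metrisability_equationE [m hm].
pose H i p := density e i p (up2 s i p) *: up2 s i p.
have uS i p (ip : cdom (A i) p) : up2 s i p \in unitmx := posdef_unit (ps i p ip).2.
have t0 i p : cdom (A i) p -> 0 < density e i p (up2 s i p).
  by move=> ip; apply: density_gt0 => //; apply: posdef_det_gt0; exact: (ps i p ip).2.
have pH i p : cdom (A i) p -> posdef (H i p).
  by move=> ip; apply: posdefZ; [exact: t0|exact: (ps i p ip).2].
have symH i p : cdom (A i) p -> (H i p)^T = H i p.
  by move=> ip; rewrite /H linearZ /= (ps i p ip).1.
have uH i p (ip : cdom (A i) p) : H i p \in unitmx := posdef_unit (pH i p ip).
have sS i := @up2_smooth _ _ _ _ s i.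
have oV i := @cimg_open _ _ _ (A i).
have sH i : smooth_mx (cmap (A i) @` cdom (A i)) (fun x => H i (cinv (A i) x)).
  by apply: smooth_scalemx => //; exact: density_smooth.
have [||g gE] := @ex_lo2 _ _ _ A (fun i p => invmx (H i p)).
- by move=> i; apply: smooth_invmx => // x /cinvP[ix _]; exact: uH.
- move=> i j p ip jp; rewrite -(invmx_congr (uH i p ip) (jacm_inv ip jp)).
  congr invmx; rewrite /H (up2_change s ip jp) (density_change ve _ ip jp).
  by rewrite -scalemxAr -scalemxAl.
have [||Y YE] := @ex_lo1 _ _ _ A (fun i p => - up1 m i p *m invmx (up2 s i p)).
- move=> i; apply: smooth_mulmx => //; first exact/smooth_oppmx/up1_smooth.
  by apply: smooth_invmx => // x /cinvP[ix _]; exact: uS.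
- move=> i j p ip jp; rewrite (up1_change m ip jp) (up2_change s ip jp).
  rewrite (invmx_congr (uS i p ip) (jacm_inv ip jp)) !mulNmx -!mulmxA.
  by rewrite (mulmxA (jacm i j p)) jacm_inv// mul1mx.
have mE i p : cdom (A i) p -> up1 m i p = - (lo1 Y i p *m up2 s i p).
  by move=> ip; rewrite YE// mulmxKV ?uS// opprK.
have [D' D'E] := ex_projective_change D Y.
have rg : riemannian_metric g.
  apply/riemannian_metricE => i p ip; rewrite gE//.
  split; first by rewrite trmx_inv_sym// symH.
  by apply: posdef_invmx; [exact: symH|exact: pH].
have lc : levi_civita g D'.
  apply/levi_civitaE; split.
    (* Exchanging a and b merely swaps the two terms in Y. *)
    apply/torsion_freeE => i p ip a b c; rewrite !D'E// !projmxE addrAC.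
    by congr (_ + _ + _); rewrite !mxE tD.
  move=> i p ip a; have Vx : (cmap (A i) @` cdom (A i)) (cmap (A i) p) by exists p.
  have := hm i p ip a; rewrite mE// => /(metrisability_proj _ _ _ _ (ps i p ip).1).
  rewrite -D'E// => dS.
  have := @density_partial_proj i p a _ (lo1 Y i p) _ (sS i) ip.
  rewrite /= !cmapK// -D'E// => /(_ _ (uS i p ip) dS) dt.
  have dH : partial_mx a (fun x => H i (cinv (A i) x)) (cmap (A i) p) =
      - ((gam D' i p a)^T *m H i p + H i p *m gam D' i p a).
    rewrite partial_mxZ; last first.
    - exact: smooth_diff_mx (sS i) Vx.
    - exact: smooth_diff (density_smooth e (sS i)) Vx.
    rewrite dt dS !cmapK// /H -scalemxAl -scalemxAr -[X in _ = - X]scalerDr.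
    rewrite scalerBr scalerA addrA -scalerDl -mulrDr.
    (* z = 2 n Y_a - 2 (n+1) Y_a + 2 Y_a: the first two terms come from the density, the last from
       sigma. *)
    set z := (X in density _ _ _ _ * X); have -> : z = 0.
      by rewrite /z -(natr1 n); move: (n%:R : R) (_ 0 0) => N y; ring.
    by rewrite mulr0 scale0r add0r.
  have HG q : cdom (A i) q -> H i (cinv (A i) (cmap (A i) q)) *m
      lo2 g i (cinv (A i) (cmap (A i) q)) = 1%:M.
    by move=> iq; rewrite cmapK// gE// mulmxV// uH.
  have := partial_mx_inverse a (sH i) (@lo2_smooth _ _ _ _ g i) HG ip.
  rewrite /= cmapK// => dHG; apply: compat_inv_conv dHG dH.
  by rewrite gE// mulmxV// uH.
exists (MetricConnection rg lc); split; first by apply/projectively_equivalentP; exists Y.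
by move=> i p ip; rewrite gE// -/(H i p) mulmxV// uH.
Qed.

End SolutionToMetric.

(** * From a metric connection to a solution *)

Section MetricToSolution.
Variables (R : realType) (n : nat) (M : topologicalType) (A : manifold R n M).
Implicit Types (i j : idx A) (p : M).
Variables (D : connection A) (e : tensor A 0 n).
Hypothesis ve : volume_form e.
Hypothesis De : forall i p, cdom (A i) p -> forall a w, covD D e i p a (idx0 n) w = 0.

(* In a chart, [g^ab = (det s) s^ab] gives [det (g^ab) = (det s)^(n+1)], hence
   the power of [det (g^ab)] by which [g^ab] has to be rescaled. *)
Definition rescaling (r : R) : R := expR (- (n.+1%:R)^-1 * ln r).

(** For k = [rescaling r] with r the density of g^-1, the tensor k g^-1 has density k^n r;
    multiplying it by that density gives k^(n+1) r g^-1, which must be g^-1. *)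
Lemma rescaling_exp r : 0 < r -> rescaling r ^+ n.+1 * r = 1.
Proof.
move=> r0; rewrite /rescaling -expRM_natl mulrA mulrN divff ?pnatr_eq0// mulN1r.
by rewrite expRN lnK ?posrE// mulVf// gt_eqF.
Qed.

Lemma metric_solution (t : metric_connection A) :
  projectively_equivalent D t -> exists s : tensor A 2 0,
  [/\ posdef_contravariant s, metrisability_equation D s & metric_of e s (mc_metric t)].
Proof.
case: t => g D' /= /riemannian_metricE pg /levi_civitaE [_ cD'] /projectively_equivalentP [Y D'E].
pose H i p := invmx (lo2 g i p); pose rho i p := density e i p (H i p).
have ug i p (ip : cdom (A i) p) : lo2 g i p \in unitmx := posdef_unit (pg i p ip).2.
have pH i p : cdom (A i) p -> posdef (H i p).
  by move=> ip; apply: posdef_invmx; [exact: (pg i p ip).1|exact: (pg i p ip).2].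
have symH i p : cdom (A i) p -> (H i p)^T = H i p.
  by move=> ip; rewrite trmx_inv_sym// (pg i p ip).1.
have r0 i p : cdom (A i) p -> 0 < rho i p.
  by move=> ip; apply: density_gt0 => //; exact/posdef_det_gt0/pH.
pose k i p := rescaling (rho i p).
have k0 i p : 0 < k i p by exact: expR_gt0.
pose S i p := k i p *: H i p.
have symS i p : cdom (A i) p -> (S i p)^T = S i p.
  by move=> ip; rewrite linearZ /= symH.
have oV i := @cimg_open _ _ _ (A i).
have sG i := @lo2_smooth _ _ _ _ g i.
have sH i : smooth_mx (cmap (A i) @` cdom (A i)) (fun x => H i (cinv (A i) x)).
  by apply: smooth_invmx => // x /cinvP[ix _]; exact: ug.
have sr i := density_smooth e (sH i).
have sl i : smooth_on (cmap (A i) @` cdom (A i)) (fun x => ln (rho i (cinv (A i) x))).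
  by apply: smooth_ln => // x /cinvP[ix _]; exact: r0.
have scl i : smooth_on (cmap (A i) @` cdom (A i))
    (fun x => - (n.+1%:R)^-1 * ln (rho i (cinv (A i) x))).
  by apply: smoothM => //; exact: smooth_cst.
have sk i : smooth_on (cmap (A i) @` cdom (A i)) (fun x => k i (cinv (A i) x)).
  exact: smooth_expR.
have sS i : smooth_mx (cmap (A i) @` cdom (A i)) (fun x => S i (cinv (A i) x)).
  exact: smooth_scalemx.
have cH i j p : cdom (A i) p -> cdom (A j) p -> H j p = (jacm i j p)^T *m H i p *m jacm i j p.
  move=> ip jp; rewrite /H (lo2_change g ip jp) -{1}[jacm j i p]trmxK.
  have JK : (jacm j i p)^T *m (jacm i j p)^T = 1%:M by rewrite -trmx_mul jacm_inv// trmx1.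
  by rewrite (invmx_congr (ug i p ip) JK) trmxK.
have cr i j p : cdom (A i) p -> cdom (A j) p -> rho j p = rho i p.
  by move=> ip jp; rewrite /rho (cH i j)// density_change.
have cS i j p : cdom (A i) p -> cdom (A j) p -> S j p = (jacm i j p)^T *m S i p *m jacm i j p.
  by move=> ip jp; rewrite /S /k (cr i j)// (cH i j)// -scalemxAr -scalemxAl.
have [s sE] := ex_up2 sS cS.
have [||mc [tm mE om]] := @ex_up1 _ _ _ A setT (fun i p => - (lo1 Y i p *m S i p)) openT.
- move=> i; rewrite cmap_setT; apply: smooth_oppmx => //.
  by apply: smooth_mulmx => //; exact: lo1_smooth.
- move=> i j p _ ip jp; rewrite (cS i j)// (lo1_change Y ip jp) !mulmxA mulNmx.
  by rewrite -(mulmxA (lo1 Y i p)) -trmx_mul jacm_inv// trmx1 mulmx1.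
pose m := Tensor tm om.
exists s; split.
- apply/posdef_contravariantE => i p ip; rewrite sE//; split; first exact: symS.
  by apply: posdefZ => //; exact: pH.
- apply/metrisability_equationE; exists m => i p ip a.
  have Vx : (cmap (A i) @` cdom (A i)) (cmap (A i) p) by exists p.
  rewrite sE// [up1 m i p]mE//; apply/metrisability_proj; first exact: symS.
  rewrite -D'E//.
  have HG q : cdom (A i) q -> lo2 g i (cinv (A i) (cmap (A i) q)) *m
      H i (cinv (A i) (cmap (A i) q)) = 1%:M.
    by move=> iq; rewrite cmapK// mulmxV// ug.
  have := partial_mx_inverse a (sG i) (sH i) HG ip.
  rewrite /= cmapK// => dGH.
  have dH := compat_inv (mulmxV (ug i p ip)) dGH (cD' i p ip a).
  (* Here c = 0, because g^-1 is parallel for D'. *)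
  have := @density_partial_proj _ _ _ _ _ _ ve De i p a _ (lo1 Y i p) 0 (sH i) ip.
  rewrite /= !cmapK// -D'E// scale0r add0r mul0r add0r => /(_ (posdef_unit (pH i p ip)) dH) dr.
  have r0' : 0 < rho i (cinv (A i) (cmap (A i) p)) by rewrite cmapK// r0.
  have [_ dl] := partial_comp a (is_derive1_ln r0') (smooth_diff (sr i) Vx).
  have [_ dk] := partial_comp a (is_derive_expR _) (smooth_diff (scl i) Vx).
  rewrite partialM ?partial_cst ?mul0r ?add0r ?dl ?dr in dk; last 2 first.
  + exact: differentiable_cst.
  + exact: smooth_diff (sl i) Vx.
  (* [s] is known to agree with [S] only on the chart domain; its image is open, which suffices for
     derivatives. *)
  transitivity (partial_mx a (fun x => S i (cinv (A i) x)) (cmap (A i) p)).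
    apply: open_eq_partial_mx (oV i) _ Vx => x; rewrite inE => /cinvP[ix _].
    exact: sE.
  rewrite partial_mxZ; [|exact: smooth_diff (sk i) Vx|exact: smooth_diff_mx (sH i) Vx].
  rewrite dk dH !cmapK// -/(rho i p) -/(rescaling (rho i p)) -/(k i p).
  rewrite /S -scalemxAl -scalemxAr scalerN scalerDr scalerA; congr (_ *: _ - _).
  have n0 : n.+1%:R != 0 :> R by rewrite pnatr_eq0.
  have rn0 : rho i p != 0 by rewrite gt_eqF// r0.
  (* The exponent - 1/(n+1) turns d rho = - 2 (n+1) Y_a rho into d k = 2 Y_a k, the multiple
     required by [metrisability_proj]. *)
  move: (n.+1%:R : R) n0 (_ 0 0) => N n0 y.
  by field; rewrite rn0 n0.
move=> i p ip /=; rewrite sE// densityZ scalerA -/(rho i p).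
have -> : k i p ^+ n * rho i p * k i p = 1.
  by rewrite mulrAC -exprSr rescaling_exp// r0.
by rewrite scale1r mulVmx// ug.
Qed.

(** Taking densities in (det s) s = (det s') s' gives (det s)^(n+1) = (det s')^(n+1), and positive
    roots are unique. *)
Lemma metric_of_inj (s s' : tensor A 2 0) (g : tensor A 0 2) :
  posdef_contravariant s -> posdef_contravariant s' ->
  metric_of e s g -> metric_of e s' g -> s = s'.
Proof.
move=> /posdef_contravariantE ps /posdef_contravariantE ps' sg s'g.
have d0 (s0 : tensor A 2 0) i p : cdom (A i) p -> posdef (up2 s0 i p) ->
    0 < density e i p (up2 s0 i p).
  by move=> ip /posdef_det_gt0; exact: density_gt0.
apply: up2_inj => i p ip.
have := d0 s i p ip (ps i p ip).2; have := d0 s' i p ip (ps' i p ip).2.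
have := sg i p ip; have := s'g i p ip.
set d := density _ _ _ _; set d' := density _ _ _ _.
move=> /mulmx1C/mulmx1_invE h' /mulmx1C/mulmx1_invE h d'0 d'1.
have SS : d' *: up2 s i p = d *: up2 s' i p by rewrite h h'.
have dd : d' = d.
  have /eqP := congr1 (density e i p) SS; rewrite !densityZ -/d -/d' -!exprSr.
  by rewrite eqrXn2// ?ltW// => /eqP.
by move: SS; rewrite dd => /scalerI; apply; rewrite gt_eqF.
Qed.

Lemma metric_of_fun (s : tensor A 2 0) (g g' : tensor A 0 2) :
  metric_of e s g -> metric_of e s g' -> g = g'.
Proof.
move=> sg sg'; apply: lo2_inj => i p ip.
by rewrite (mulmx1_invE (sg i p ip)) (mulmx1_invE (sg' i p ip)).
Qed.

Lemma metric_of_conformal (s : tensor A 2 0) (g : tensor A 0 2) :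
  posdef_contravariant s -> metric_of e s g -> inverse_conformal_to g s.
Proof.
move=> /posdef_contravariantE ps sg.
(* The factor needs a chart at each point; [density_change] makes the choice immaterial. *)
have [ch chP] := choice (charts_cover A).
exists (fun p => density e (ch p) p (up2 s (ch p) p)) => [p|i p ip a c].
  by apply: density_gt0 => //; apply: posdef_det_gt0; exact: (ps _ _ (chP p)).2.
rewrite (up2_change s ip (chP p)) density_change//.
have /matrixP/(_ a c) := sg i p ip; rewrite !mxE /delta => <-.
by apply: eq_bigr => b _; rewrite !mxE.
Qed.

Lemma metric_connection_unique (t t' : metric_connection A) :
  mc_metric t = mc_metric t' -> t = t'.
Proof.
move=> tt'; apply: metric_connection_eq => //.
have /riemannian_metricE pg := mc_riemannian t.
apply: (levi_civita_unique _ (mc_levi_civita t)); last by rewrite tt'; exact: mc_levi_civita.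
by move=> i p ip; split; [exact: posdef_unit (pg i p ip).2|exact: (pg i p ip).1].
Qed.

End MetricToSolution.

(** * The bijection *)

Theorem theorem2p3 (R : realType) (n : nat) (M : topologicalType)
    (A : manifold R n M) (o : orientation A)
    (D : connection A) (hD : special D) :
  exists F : posdef_solution D -> equivalent_metric_connection D,
    bijective F /\
    forall s : posdef_solution D,
      inverse_conformal_to (mc_metric (proj1_sig (F s))) (proj1_sig s).
Proof.
have [tD [e [ve De]]] := hD.
have exF (s : posdef_solution D) : exists t : equivalent_metric_connection D,
    metric_of e (proj1_sig s) (mc_metric (proj1_sig t)).
  have [ps es] := proj2_sig s; have [t [Dt st]] := solution_metric tD ve De ps es.
  by exists (exist _ t Dt).
have exG (t : equivalent_metric_connection D) : exists s : posdef_solution D,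
    metric_of e (proj1_sig s) (mc_metric (proj1_sig t)).
  have [s [ps es st]] := metric_solution ve De (proj2_sig t).
  by exists (exist _ s (conj ps es)).
have [F FP] := choice exF; have [G GP] := choice exG.
exists F; split; last by move=> s; apply: metric_of_conformal (FP s) => //; exact: (proj2_sig s).1.
(* [G (F s)] and [s] have the same metric; [F (G t)] and [t] have metrics determined by the same
   solution [G t]. *)
exists G => [s|t]; (apply: eq_sig_hprop; first by move=> *; exact: Prop_irrelevance).
  by apply: (metric_of_inj ve _ _ (GP (F s)) (FP s)); [exact: (proj2_sig (G (F s))).1|exact: (proj2_sig s).1].
by apply: metric_connection_unique; exact: metric_of_fun (FP (G t)) (GP t).
Qed.
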